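(* Let $P\mapsto R_P$ and $P\mapsto S_P$ belong to $\mathcal{S}$, let $\psi_n\triangleq\mathbb{U}_n\Gamma_n$, and let $K_{1n}\triangleq\|L_{\hat P_n}^{RS}\|_{1,P_0}+\|M_{\hat P_n}^{RS}\|_{2,P_0}^2$. Suppose that $K_{1n}=o_{P_0}(n^{-1/2})$, that $\mathbb{U}_n\tilde\Gamma_n=o_{P_0}(n^{-1/2})$, and that $o_1\mapsto\int\Gamma_n(o_1,o)\,dP_0(o)$ belongs to a fixed $P_0$-Donsker class with probability tending to $1$ while $\|P_0(\Gamma_n-\Gamma_0)\|_{2,P_0}=o_{P_0}(1)$. Furthermore, suppose that $\tau^2\triangleq4\,\mathrm{Var}_{P_0}[\int\Gamma_0(O,o)dP_0(o)]>0$ and that the data-dependent cutoff satisfies $\hat q_{1-\alpha}^{ub}=o_{P_0}(n)$. Then, if $R_0(O)$ and $S_0(O)$ are not equal in distribution under $P_0$, the test that rejects when $n\psi_n>\hat q_{1-\alpha}^{ub}$ is consistent in the sense that $$\lim_{n\to\infty}P_0^n\left(n\psi_n>\hat q_{1-\alpha}^{ub}\right)=1 .$$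
   Context: Model and parameters. $\mathcal{M}$ is the nonparametric model of distributions for an observation $O$ taking values in $\mathcal{O}$. $O_1,\dots,O_n$ are i.i.d. from the true distribution $P_0\in\mathcal{M}$ (joint law $P_0^n$), and $\hat P_n\in\mathcal{M}$ is an estimator of $P_0$ based on these data. $P\mapsto R_P$ and $P\mapsto S_P$ map $\mathcal{M}$ into bounded real-valued measurable functions on $\mathcal{O}$. A subscript $0$ denotes evaluation at $P_0$ (e.g. $R_0=R_{P_0}$, $\Gamma_0=\Gamma_{P_0}$). The null hypothesis is $R_0(O)\overset{d}{=}S_0(O)$. For $\alpha\in(0,1)$, $\hat q_{1-\alpha}^{ub}$ is a real-valued statistic used as the test cutoff, chosen so that $\limsup_n P_0^n(n\psi_n>\hat q_{1-\alpha}^{ub})\le\alpha$ when the null hypothesis holds. Class $\mathcal{S}$: all mappings $T$ for which there is a measurable function $X^T$ on $\mathcal{O}$ (write $x^T=X^T(o)$, and $T_P(o)=T_P(x^T)$) such that: (S1) $T_P$ is a measurable mapping with domain $\{X^T(o):o\in\mathcal{O}\}$ and range contained in $[-b,b]$ for some $0\le b<\infty$ independent of $P$; (S2) for all submodels $dP_t/dP=1+th$ with bounded $h$, $Ph=0$, there exist $\delta>0$ and a set $\mathcal{O}_1\subseteq\mathcal{O}$ with $P_0(\mathcal{O}_1)=1$ such that for all $(o,t_1)\in\mathcal{O}_1\times(-\delta,\delta)$, $t\mapsto T_{P_t}(x^T)$ is twice differentiable at $t_1$ with first and second derivatives uniformly bounded (in $x^T$); (S3) for any $P\in\mathcal{M}$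 and submodel $dP_t/dP=1+th$ with bounded $h$, $Ph=0$, there is a function $D_P^T:\mathcal{O}\to\mathbb{R}$ (depending on $T$ and $P$, not on $h$, as the notation indicates), uniformly bounded in $P$ and $o$, such that $\int D_P^T(o)\,dP(o|x^T)=0$ for almost all $o\in\mathcal{O}$ and $\frac{d}{dt}T_{P_t}(x^T)|_{t=0}=\int D_P^T(o)h(o)\,dP(o|x^T)$, where $P(\cdot|x^T)$ is the conditional distribution of $O$ given $X^T=x^T$ under $P$. For $T,U\in\mathcal{S}$, $$\Gamma_P^{TU}(o_1,o_2)\triangleq\Big[2[T_P(o_1)-U_P(o_2)][D_P^U(o_2)-D_P^T(o_1)]+1-\{4[T_P(o_1)-U_P(o_2)]^2-2\}D_P^T(o_1)D_P^U(o_2)\Big]e^{-[T_P(o_1)-U_P(o_2)]^2},$$ $\Gamma_P\triangleq\Gamma_P^{RR}-\Gamma_P^{RS}-\Gamma_P^{SR}+\Gamma_P^{SS}$, and $$\tilde\Gamma_P(o_1,o_2)\triangleq\Gamma_P(o_1,o_2)-\int\Gamma_P(o_1,o)dP_0(o)-\int\Gamma_P(o,o_2)dP_0(o)+P_0^2\Gamma_P.$$ $\Gamma_n\triangleq\Gamma_{\hat P_n}$, $\tilde\Gamma_n\triangleq\tilde\Gamma_{\hat P_n}$. Notation: $P_0^2f=\iint f\,dP_0dP_0$; for $f$ on $\mathcal{O}^2$, $P_0f$ is the function $o_1\mapsto\int f(o_1,o)dP_0(o)$; $\mathbb{U}_n f=\frac{1}{n(n-1)}\sum_{i\ne j}f(O_i,O_j)$.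 For $T\in\mathcal{S}$, $\mathrm{Rem}_P^T(o)\triangleq T_P(o)-T_0(o)+\int D_P^T(o_1)[dP_0(o_1|x^T)-dP(o_1|x^T)]$. Further $L_P^{RS}(o)\triangleq\max\{|\mathrm{Rem}_P^R(o)|,|\mathrm{Rem}_P^S(o)|\}$, $M_P^{RS}(o)\triangleq\max\{|R_P(o)-R_0(o)|,|S_P(o)-S_0(o)|\}$, and $\|f\|_{p,P_0}\triangleq[\int|f(o)|^pdP_0(o)]^{1/p}$. *)

(* Defs.v *)
From HB Require Import structures.
From mathcomp Require Import all_boot all_order all_algebra.
From mathcomp Require Import all_classical all_reals all_analysis.

Set Implicit Arguments.
Unset Strict Implicit.
Unset Printing Implicit Defensive.

Import Order.TTheory GRing.Theory Num.Theory.
Import numFieldNormedType.Exports.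

Local Open Scope classical_set_scope.
Local Open Scope ring_scope.

Section iid.
Context d (O : measurableType d) (R : realType).

Definition tcons n (x : O * n.-tuple O) : n.+1.-tuple O :=
  [the n.+1.-tuple O of x.1 :: x.2].

Lemma measurable_tcons n : measurable_fun setT (@tcons n).
Proof. exact: measurable_cons. Qed.

HB.instance Definition _ n :=
  isMeasurableFun.Build _ _ _ _ (@tcons n) (@measurable_tcons n).

(* The product measure P^n on O^n: P^(n+1) is the image of P \x P^n under
   (o, w) |-> o :: w. *)
Fixpoint iid_law (P : probability O R) n : probability (n.-tuple O) R :=
  if n is m.+1 then distribution (P \x iid_law P m)%E (@tcons m)
  else \d_([tuple]).

End iid.

Section asymptotics.
Context d (O : measurableType d) (R : realType).
Implicit Types (P : probability O R) (n : nat).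

(* Stochastic order symbols and "with probability tending to one" are expressed
   with the outer measure (iid_law P n)^*, which is the law itself on measurable
   events; no measurability of the data-dependent objects is then needed. *)
Definition little_oP P (Z : forall n, n.-tuple O -> R) (r : nat -> R) :=
  forall e : R, 0 < e ->
    (((iid_law P n)^*)%mu [set w | e * r n < `|Z n w|]) @[n --> \oo] --> 0%E.

Definition wp_to_1 P (E : forall n, set (n.-tuple O)) :=
  (((iid_law P n)^*)%mu (~` E n)) @[n --> \oo] --> 0%E.

Definition Ustat n (f : O -> O -> R) (w : n.-tuple O) : R :=
  (n%:R * (n%:R - 1))^-1 *
  \sum_(i < n) \sum_(j < n | i != j) f (tnth w i) (tnth w j).

Definition normLp P (p : R) (f : O -> R) : R :=
  fine ('N[P]_(p%:E)[EFin \o f])%E.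

Definition eq_in_dist P (X Y : O -> R) :=
  forall B : set R, measurable B -> pushforward P X B = pushforward P Y B.

End asymptotics.

Section donsker.
Context d (O : measurableType d) (R : realType).

Definition outer_expectation d' (T : measurableType d') (Q : probability T R)
    (Z : T -> R) : \bar R :=
  ereal_inf [set 'E_Q[U]%E | U in
    [set U : T -> R | Q.-integrable setT (EFin \o U) /\
                      forall w, Z w <= U w]].

(* l^oo(F), as the subspace of F-bounded elements of the functions
   z : (O -> R) -> R with the topology of uniform convergence on F (values off F
   are irrelevant to that topology, hence to its Borel sets). *)
Definition ellinfty (F : set (O -> R)) : set {uniform` F -> R} :=
  [set z | exists C : R, forall f, F f -> `|z f| <= C].
Arguments ellinfty : clear implicits.

Definition empirical_process (P : probability O R) (F : set (O -> R)) n
    (w : n.-tuple O) : {uniform` F -> R} :=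
  fun f : O -> R =>
    Num.sqrt n%:R * (n%:R^-1 * \sum_(i < n) f (tnth w i) - \int[P]_o f o).

(* F is P-Donsker: the empirical process indexed by F converges weakly (in the
   outer-expectation sense of Hoffmann-Jorgensen) in l^oo(F) to a tight Borel
   limit, whose law is L. A compact set of the (non-separated) space
   {uniform` F -> R} need not be Borel, whence [closed K]; the closure of a
   compact set is compact. *)
Definition donsker (P : probability O R) (F : set (O -> R)) :=
  [/\ forall f, F f -> f \in Lfun P 2%:E,
      forall o, exists C : R, forall f, F f -> `|f o - \int[P]_x f x| <= C &
      exists L : probability (g_sigma_algebraType (@open {uniform` F -> R})) R,
      [/\ L (ellinfty F) = 1%E,
          forall e : R, 0 < e -> exists K : set {uniform` F -> R},
            [/\ compact K, closed K, K `<=` ellinfty F & (L (~` K) <= e%:E)%E] &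
          forall H : {uniform` F -> R} -> R,
            {within ellinfty F, continuous H} ->
            (exists C : R, forall z, ellinfty F z -> `|H z| <= C) ->
            outer_expectation (iid_law P n)
              (fun w => H (empirical_process P F w)) @[n --> \oo]
            --> (\int[L]_(z in ellinfty F) (H z)%:E)%E]].

End donsker.

Arguments ellinfty {d O R} F _.

Section class_S.
Context d (O : measurableType d) (R : realType).

(* Pt is a submodel through P with dP_t/dP = 1 + t h, h bounded and P h = 0.
   The density is prescribed only for small |t|, where 1 + t h >= 0. *)
Definition submodel (P : probability O R) (h : O -> R)
    (Pt : R -> probability O R) :=
  [/\ measurable_fun setT h,
      exists C : R, forall o, `|h o| <= C,
      \int[P]_o h o = 0,
      Pt 0 = P &
      \forall t \near (0 : R), forall A : set O, measurable A ->
        Pt t A = (\int[P]_(o in A) (1 + t * h o)%:E)%E].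

(* Nonparametric: every such submodel stays in M near t = 0. The set of all
   distributions satisfies this. *)
Definition nonparametric (M : set (probability O R)) :=
  forall P h Pt, M P -> submodel P h Pt -> \forall t \near (0 : R), M (Pt t).

(* kappa x is (a version of) the law of O given X = x under P. *)
Definition conditional_law (P : probability O R) d' (X : measurableType d')
    (XT : O -> X) (kappa : R.-pker X ~> O) :=
  forall (A : set X) (B : set O), measurable A -> measurable B ->
    P (XT @^-1` A `&` B) = (\int[P]_(o in XT @^-1` A) kappa (XT o) B)%E.

(* A mapping P |-> T_P together with the objects that the class S attaches to it:
   X^T, the function T_P of x^T, D_P^T, and P(.|x^T). *)
Record mapping := Mapping {
  map_disp : measure_display ;
  map_space : measurableType map_disp ;
  map_X : O -> map_space ;
  map_fun : probability O R -> map_space -> R ;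
  map_D : probability O R -> O -> R ;
  map_cond : probability O R -> R.-pker map_space ~> O }.
Arguments map_X : clear implicits.
Arguments map_fun : clear implicits.
Arguments map_D : clear implicits.
Arguments map_cond : clear implicits.

Definition map_val (T : mapping) (P : probability O R) (o : O) : R :=
  map_fun T P (map_X T o).

(* In S1, T_P is represented by a measurable function on the whole codomain of
   X^T (a real function on the range of X^T, measurable for the trace
   sigma-algebra, has such an extension); only its values on the range matter.
   In S3, "almost all" refers to P0, as does the set O1 of S2. *)
Record in_S (M : set (probability O R)) (P0 : probability O R)
    (T : mapping) : Prop := InS {
  S_X : measurable_fun setT (map_X T) ;
  S_cond : forall P, M P -> conditional_law P (map_X T) (map_cond T P) ;
  S1_meas : forall P, M P -> measurable_fun setT (map_fun T P) ;
  S1_bounded : exists2 b : R, 0 <= b &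
    forall P, M P -> forall o, map_val T P o \in `[- b, b] ;
  S2 : forall P h Pt, M P -> submodel P h Pt ->
    exists delta : R, exists O1 : set O,
    [/\ 0 < delta, measurable O1, P0 O1 = 1%E &
      forall t1 : R, - delta < t1 < delta -> exists C : R, forall o, O1 o ->
        let f : R -> R := fun t => map_val T (Pt t) o in
        [/\ derivable f t1 1, derivable (derive1 f) t1 1,
            `|derive1 f t1| <= C & `|derive1 (derive1 f) t1| <= C]] ;
  S3_D_meas : forall P, M P -> measurable_fun setT (map_D T P) ;
  S3_D_bounded : exists C : R, forall P, M P -> forall o, `|map_D T P o| <= C ;
  S3_D_mean0 : forall P, M P ->
    {ae P0, forall o, \int[map_cond T P (map_X T o)]_u map_D T P u = 0} ;
  S3_derivative : forall P h Pt, M P -> submodel P h Pt ->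
    {ae P0, forall o,
      is_derive (0 : R) (1 : R) (fun t : R => map_val T (Pt t) o)
        (\int[map_cond T P (map_X T o)]_u (map_D T P u * h u))} }.

Definition Gamma2 (T U : mapping) (P : probability O R) (o1 o2 : O) : R :=
  let D1 := map_D T P o1 in
  let D2 := map_D U P o2 in
  let e := map_val T P o1 - map_val U P o2 in
  (2 * e * (D2 - D1) + 1 - (4 * e ^+ 2 - 2) * D1 * D2) * expR (- e ^+ 2).

Definition Gamma (RT ST : mapping) (P : probability O R) (o1 o2 : O) : R :=
  Gamma2 RT RT P o1 o2 - Gamma2 RT ST P o1 o2
  - Gamma2 ST RT P o1 o2 + Gamma2 ST ST P o1 o2.

Definition integrate_snd (P0 : probability O R) (f : O -> O -> R) (o1 : O) : R :=
  \int[P0]_o f o1 o.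

Definition centered (P0 : probability O R) (f : O -> O -> R) (o1 o2 : O) : R :=
  f o1 o2 - \int[P0]_o f o1 o - \int[P0]_o f o o2
  + \int[P0]_u \int[P0]_v f u v.

Definition Rem (P0 : probability O R) (T : mapping) (P : probability O R)
    (o : O) : R :=
  map_val T P o - map_val T P0 o
  + (\int[map_cond T P0 (map_X T o)]_u map_D T P u
     - \int[map_cond T P (map_X T o)]_u map_D T P u).

Definition LRS (P0 : probability O R) (RT ST : mapping) (P : probability O R)
    (o : O) : R :=
  Num.max `|Rem P0 RT P o| `|Rem P0 ST P o|.

Definition MRS (P0 : probability O R) (RT ST : mapping) (P : probability O R)
    (o : O) : R :=
  Num.max `|map_val RT P o - map_val RT P0 o|
          `|map_val ST P o - map_val ST P0 o|.

Definition K1 (P0 : probability O R) (RT ST : mapping) (P : probability O R) :=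
  normLp P0 1 (LRS P0 RT ST P) + normLp P0 2 (MRS P0 RT ST P) ^+ 2.

Definition tau2 (P0 : probability O R) (RT ST : mapping) : \bar R :=
  (4%:E * variance P0 (integrate_snd P0 (Gamma RT ST P0)))%E.

End class_S.

Section test.
Context d (O : measurableType d) (R : realType).

Definition psi (RT ST : mapping O R)
    (hatP : forall n, n.-tuple O -> probability O R) n (w : n.-tuple O) : R :=
  Ustat (Gamma RT ST (hatP n w)) w.

Definition reject (RT ST : mapping O R)
    (hatP : forall n, n.-tuple O -> probability O R)
    (q : forall n, n.-tuple O -> R) n : set (n.-tuple O) :=
  [set w | n%:R * psi RT ST hatP w > q n w].

End test.

Arguments reject {d O R} RT ST hatP q n.

(* Main.v *)
(** By symmetry of [Gamma_n], the statistic [psi_n] is the degenerate U-statistic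
    of the centered kernel, plus [2 (P_n - P0) g_n], plus [P0 g_n], where
    [g_n = P0 Gamma_n]. The first term is negligible by hypothesis, the second
    because [g_n] stays in a Donsker class, and [P0 g_n] tends to [P0^2 Gamma_0]
    because [||g_n - g_0||_2] tends to [0]. Conditionally on [x^T] the gradient
    [D^T] has mean zero, so [P0^2 Gamma_0] is the squared maximum mean discrepancy,
    for the Gaussian kernel, between the laws of [R_0(O)] and [S_0(O)]; it is
    positive when these differ. Hence [n psi_n] eventually exceeds a fixed positive
    multiple of [n], and the cutoff does not. *)

Require Import Defs.
From HB Require Import structures.
From mathcomp Require Import all_boot all_order all_algebra.
From mathcomp Require Import all_classical all_reals all_analysis.
From mathcomp Require Import measurable_realfun ring lra.

Set Implicit Arguments.
Unset Strict Implicit.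
Unset Printing Implicit Defensive.

Import Order.TTheory GRing.Theory Num.Theory.
Import numFieldNormedType.Exports.

Local Open Scope classical_set_scope.
Local Open Scope ring_scope.

(** * Bounded measurable functions *)

(** Since [R_0] and [S_0] are bounded, positivity of the discrepancy can be had from moments,
    without Fourier analysis. Expanding the factor e^(2xy) of the kernel displays the discrepancy as
    a series of positive multiples of squared differences of Gaussian-weighted moments; if it is not
    positive, all these differences vanish. Multiplying by the series of e^(x^2) then removes the
    weight, and plain moments determine a bounded law, because explicit polynomials converge
    boundedly to the indicator of a half-line. The estimator [hatP] is an arbitrary function of the
    data, so the events about it are handled as bare sets: the probabilistic part is an inclusion of
    the acceptance region in a union of sets of vanishing outer measure. For each fixed distribution
    in [M], on the other hand, the kernels are bounded and measurable, and [bmfun] is the one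
    predicate from which their integrability, Fubini and dominated convergence follow. *)

Definition bmfun d (T : measurableType d) (R : realType) (f : T -> R) :=
  measurable_fun setT f /\ exists C : R, forall x, `|f x| <= C.

Section bounded_measurable.
Context d (T : measurableType d) (R : realType).
Implicit Types (f g : T -> R).

Lemma bmfun_cst (c : R) : bmfun (fun _ : T => c).
Proof. by split; [exact: measurable_cst|exists `|c|]. Qed.

Lemma bmfunD f g : bmfun f -> bmfun g -> bmfun (fun x => f x + g x).
Proof.
move=> [mf [C fC]] [mg [K gK]]; split; first exact: measurable_funD.
by exists (C + K) => x; rewrite (le_trans (ler_normD _ _))// lerD.
Qed.

Lemma bmfunN f : bmfun f -> bmfun (fun x => - f x).
Proof.
move=> [mf [C fC]]; split; first exact: measurableT_comp.
by exists C => x; rewrite normrN.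
Qed.

Lemma bmfunB f g : bmfun f -> bmfun g -> bmfun (fun x => f x - g x).
Proof. by move=> bf bg; apply: bmfunD => //; exact: bmfunN. Qed.

Lemma bmfunM f g : bmfun f -> bmfun g -> bmfun (fun x => f x * g x).
Proof.
move=> [mf [C fC]] [mg [K gK]]; split; first exact: measurable_funM.
by exists (C * K) => x; rewrite normrM ler_pM.
Qed.

Lemma bmfunX f n : bmfun f -> bmfun (fun x => f x ^+ n).
Proof.
move=> bf; elim: n => [|n IH]; first exact: bmfun_cst.
rewrite (_ : (fun x => _) = (fun x => f x * f x ^+ n)); first exact: bmfunM.
by apply/funext => x; rewrite exprS.
Qed.

Lemma bmfun_norm f : bmfun f -> bmfun (fun x => `|f x|).
Proof.
move=> [mf [C fC]]; split; first exact: measurableT_comp.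
by exists C => x; rewrite normr_id.
Qed.

Lemma bmfun_expR f : bmfun f -> bmfun (fun x => expR (f x)).
Proof.
move=> [mf [C fC]]; split; first exact: measurableT_comp.
exists (expR C) => x; rewrite ger0_norm ?expR_ge0// ler_expR.
by rewrite (le_trans (ler_norm _)).
Qed.

Lemma bmfun_sum (I : Type) (s : seq I) (F : I -> T -> R) :
  (forall i, bmfun (F i)) -> bmfun (fun x => \sum_(i <- s) F i x).
Proof.
move=> bF; elim: s => [|i s IH].
  rewrite (_ : (fun x => _) = (fun=> 0)); first exact: bmfun_cst.
  by apply/funext => x; rewrite big_nil.
rewrite (_ : (fun x => _) = (fun x => F i x + \sum_(j <- s) F j x)).
  exact: bmfunD.
by apply/funext => x; rewrite big_cons.
Qed.

Lemma bmfun_comp d' (T' : measurableType d') (h : T' -> T) f :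
  measurable_fun setT h -> bmfun f -> bmfun (f \o h).
Proof.
move=> mh [mf [C fC]]; split; first exact: measurableT_comp.
by exists C => x; exact: fC.
Qed.

End bounded_measurable.

Ltac bm := repeat first [assumption | apply: bmfun_cst | apply: bmfunB
  | apply: bmfunD | apply: bmfunN | apply: bmfunM | apply: bmfunX
  | apply: bmfun_norm | apply: bmfun_expR].

Section bounded_measurable_integral.
Context d (T : measurableType d) (R : realType) (P : probability T R).
Implicit Types (f g : T -> R).

Lemma bmfun_integrable f : bmfun f -> P.-integrable setT (EFin \o f).
Proof.
move=> [mf [C fC]]; apply: measurable_bounded_integrable => //.
  by rewrite (le_lt_trans (probability_le1 P _)) ?ltry.
exists C; split; first exact: num_real.
by move=> x Cx y _; apply: (le_trans (fC y)); exact: ltW.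
Qed.

Lemma bmfun_integralE f : bmfun f ->
  (\int[P]_x (f x)%:E)%E = (\int[P]_x f x)%:E.
Proof.
move=> bf; rewrite /Rintegral fineK//.
exact: integrable_fin_num (bmfun_integrable bf).
Qed.

Lemma RintegralD_bm f g : bmfun f -> bmfun g ->
  \int[P]_x (f x + g x) = \int[P]_x f x + \int[P]_x g x.
Proof. by move=> bf bg; rewrite RintegralD//; exact: bmfun_integrable. Qed.

Lemma RintegralB_bm f g : bmfun f -> bmfun g ->
  \int[P]_x (f x - g x) = \int[P]_x f x - \int[P]_x g x.
Proof. by move=> bf bg; rewrite RintegralB//; exact: bmfun_integrable. Qed.

Lemma RintegralZl_bm f (r : R) : bmfun f ->
  \int[P]_x (r * f x) = r * \int[P]_x f x.
Proof. by move=> bf; rewrite RintegralZl//; exact: bmfun_integrable. Qed.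

Lemma Rintegral_cst_prob (c : R) : \int[P]_x c = c.
Proof.
rewrite Rintegral_cst// [X in fine X](_ : _ = 1%E) ?mulr1//.
exact: probability_setT.
Qed.

Lemma Rintegral_sum_bm (I : Type) (s : seq I) (F : I -> T -> R) :
  (forall i, bmfun (F i)) ->
  \int[P]_x (\sum_(i <- s) F i x) = \sum_(i <- s) \int[P]_x F i x.
Proof.
move=> bF; elim: s => [|i s IH].
  rewrite big_nil; under eq_Rintegral do rewrite big_nil.
  exact: Rintegral_cst_prob.
rewrite big_cons -IH -RintegralD_bm//; last exact: bmfun_sum.
by apply: eq_Rintegral => x _; rewrite big_cons.
Qed.

Lemma le_Rintegral_bm f g : bmfun f -> bmfun g -> (forall x, f x <= g x) ->
  \int[P]_x f x <= \int[P]_x g x.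
Proof. by move=> bf bg fg; apply: le_Rintegral => //; exact: bmfun_integrable. Qed.

Lemma normr_Rintegral_le f (c : R) : bmfun f -> (forall x, `|f x| <= c) ->
  `|\int[P]_x f x| <= c.
Proof.
move=> bf fc; rewrite (le_trans (le_normr_Rintegral _ (bmfun_integrable bf)))//.
rewrite -[leRHS]Rintegral_cst_prob; apply: le_Rintegral_bm => //.
  exact: bmfun_norm.
exact: bmfun_cst.
Qed.

Lemma cvg_Rintegral_bm (F : nat -> T -> R) f (C : R) :
  (forall n, bmfun (F n)) -> bmfun f -> (forall n x, `|F n x| <= C) ->
  (forall x, F n x @[n --> \oo] --> f x) ->
  \int[P]_x F n x @[n --> \oo] --> \int[P]_x f x.
Proof.
move=> bF bf FC Ff.
have [|||||_ _] := @dominated_convergence _ _ _ P setT measurableT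
  (fun n => EFin \o F n) (EFin \o f) (cst C%:E).
- by move=> n; apply/measurable_EFinP; exact: (bF n).1.
- by apply/measurable_EFinP; exact: bf.1.
- by apply: aeW => x _; apply: cvg_EFin; [exact: nearW|exact: Ff].
- by apply: bmfun_integrable; exact: bmfun_cst.
- by apply: aeW => x n _; rewrite /= lee_fin.
- by rewrite /= bmfun_integralE//; exact: fine_cvg.
Qed.

Lemma Rintegral_sqr_le f : bmfun f -> (\int[P]_x f x) ^+ 2 <= \int[P]_x (f x ^+ 2).
Proof.
move=> bf; set m := \int[P]_x f x.
have : 0 <= \int[P]_x ((f x - m) ^+ 2).
  by apply: Rintegral_ge0 => x _; exact: sqr_ge0.
have -> : \int[P]_x ((f x - m) ^+ 2) =
    \int[P]_x (f x ^+ 2 + ((- 2 * m) * f x + m ^+ 2)).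
  by apply: eq_Rintegral => x _; ring.
rewrite RintegralD_bm; [|by bm|by bm].
rewrite RintegralD_bm; [|by bm|by bm].
  by rewrite RintegralZl_bm// Rintegral_cst_prob -/m; nra.
Qed.

End bounded_measurable_integral.

Lemma normLp2E d (O : measurableType d) (R : realType) (P : probability O R)
    (f : O -> R) : bmfun f ->
  normLp P 2 f = Num.sqrt (\int[P]_x (f x ^+ 2)).
Proof.
move=> bf; rewrite /normLp unlock/=.
rewrite fine_poweR; have -> : (\int[P]_x (`|(EFin \o f) x| `^ 2))%E =
    (\int[P]_x ((f x ^+ 2)%:E))%E.
  apply: eq_integral => x _ /=.
  by rewrite powR_mulrn// -normrX ger0_norm ?sqr_ge0.
rewrite -/(Rintegral P setT (fun x => f x ^+ 2)) powR12_sqrt//.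
by apply: Rintegral_ge0 => x _; exact: sqr_ge0.
Qed.

Lemma bmfun_slice d1 d2 (T1 : measurableType d1) (T2 : measurableType d2)
    (R : realType) (f : T1 -> T2 -> R) x : bmfun (uncurry f) -> bmfun (f x).
Proof. by move=> bf; exact: (bmfun_comp (pair1_measurable x) bf). Qed.

Lemma bmfun_Rintegral d1 d2 (T1 : measurableType d1) (T2 : measurableType d2)
    (R : realType) (P : probability T2 R) (f : T1 -> T2 -> R) :
  bmfun (uncurry f) -> bmfun (fun x => \int[P]_y f x y).
Proof.
move=> bf; have [mf [C fC]] := bf; split; last first.
  exists C => x; apply: normr_Rintegral_le; first exact: bmfun_slice.
  by move=> y; exact: (fC (x, y)).
(* Tonelli's measurability statement wants a nonnegative integrand, so [f] is shifted by its bound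
   [C], which is subtracted again afterwards. *)
have -> : (fun x => \int[P]_y f x y) =
    (fun x => fine (fubini_F P (fun z => (uncurry f z + C)%:E) x) - C).
  apply/funext => x; rewrite -[fine _]/(\int[P]_y (f x y + C)).
  rewrite RintegralD_bm; [|exact: bmfun_slice|exact: bmfun_cst].
  by rewrite Rintegral_cst_prob addrK.
apply: measurable_funB; last exact: measurable_cst.
apply: measurableT_comp => //; apply: measurable_fun_fubini_tonelli_F.
  by apply/measurable_EFinP; apply: measurable_funD.
move=> z; rewrite lee_fin -lerBlDr sub0r.
by have := fC z; rewrite ler_norml => /andP[].
Qed.

Lemma bmfun_swap d1 d2 (T1 : measurableType d1) (T2 : measurableType d2)
  (R : realType) (f : T1 -> T2 -> R) :
  bmfun (uncurry f) -> bmfun (uncurry (fun y x => f x y)).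
Proof.
move=> bf; rewrite (_ : uncurry _ = uncurry f \o (@unstable.swap T2 T1)); last first.
  by apply/funext => -[].
by apply: bmfun_comp bf; exact: measurable_swap.
Qed.

Lemma Rintegral_swap d1 d2 (T1 : measurableType d1) (T2 : measurableType d2)
  (R : realType) (P1 : probability T1 R) (P2 : probability T2 R)
  (f : T1 -> T2 -> R) : bmfun (uncurry f) ->
  \int[P1]_x \int[P2]_y f x y = \int[P2]_y \int[P1]_x f x y.
Proof.
move=> bf; apply: EFin_inj; rewrite -!bmfun_integralE; first last.
- exact: (bmfun_Rintegral P2 bf).
- exact: (bmfun_Rintegral P1 (bmfun_swap bf)).
transitivity (\int[P1]_x \int[P2]_y (f x y)%:E)%E.
  by apply: eq_integral => x _; rewrite bmfun_integralE//; exact: bmfun_slice.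
rewrite (Fubini (bmfun_integrable (P1 \x P2)%E bf)); apply: eq_integral => y _.
by rewrite /= bmfun_integralE//; exact: (bmfun_slice y (bmfun_swap bf)).
Qed.

(** * Exponential sums and polynomial approximation of a step *)

Section exponential_sums.
Context (R : realType).
Implicit Types (c e x y : R).

Definition exp_sum n x : R := \sum_(k < n) x ^+ k / k`!%:R.

Lemma exp_sum_series n x : exp_sum n x = series (exp_coeff x) n.
Proof. by rewrite /series/= big_mkord. Qed.

Lemma cvg_exp_sum x : exp_sum n x @[n --> \oo] --> expR x.
Proof.
rewrite (_ : exp_sum^~ x = series (exp_coeff x)).
  exact: is_cvg_series_exp_coeff.
by apply/funext => n; rewrite exp_sum_series.
Qed.

(** Term by term, a block of the series at [x] is dominated by the same block at [y]. Convergence at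
    one endpoint is therefore uniform on the whole interval. *)
Lemma exp_sum_dist_le m n x y : (n <= m)%N -> `|x| <= y ->
  `|exp_sum m x - exp_sum n x| <= exp_sum m y - exp_sum n y.
Proof.
move=> /subnKC <- xy; elim: (m - n)%N => [|k IH]; first by rewrite addn0 !subrr normr0.
rewrite addnS /exp_sum !big_ord_recr/= -/(exp_sum _ _) -/(exp_sum _ _).
rewrite addrAC [in leRHS]addrAC (le_trans (ler_normD _ _))// lerD// normrM normfV.
by rewrite normrX normr_nat ler_wpM2r ?invr_ge0// lerXn2r ?nnegrE ?(le_trans _ xy).
Qed.

Lemma exp_sum_le n x : 0 <= x -> exp_sum n x <= expR x.
Proof.
move=> x0; have /cvgP := @cvg_exp_sum x => cv.
rewrite -(cvg_lim (@Rhausdorff R) (@cvg_exp_sum x)).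
apply: nondecreasing_cvgn_le => //; apply/nondecreasing_seqP => k.
by rewrite /exp_sum big_ord_recr/= lerDl divr_ge0// exprn_ge0.
Qed.

Lemma exp_sum_unif c e : 0 <= c -> 0 < e ->
  \forall n \near \oo, forall x, `|x| <= c -> `|expR x - exp_sum n x| <= e.
Proof.
move=> c0 e0; have /cvgrPdist_le/(_ e e0) := @cvg_exp_sum c.
apply: filterS => n nc x xc.
have cv : `|exp_sum m x - exp_sum n x| @[m --> \oo] --> `|expR x - exp_sum n x|.
  by apply: cvg_norm; apply: cvgB; [exact: cvg_exp_sum|exact: cvg_cst].
rewrite -(cvg_lim (@Rhausdorff R) cv); apply: limr_le; first exact: cvgP cv.
near=> m; rewrite (le_trans (exp_sum_dist_le _ xc))//.
  by near: m; exact: nbhs_infty_ge.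
rewrite (le_trans _ nc)// (le_trans _ (ler_norm _))// lerD2r.
exact: exp_sum_le.
Unshelve. all: by end_near. Qed.

End exponential_sums.

(** * Polynomials converging to a step at one half *)

Section threshold.
Context (R : realType).
Implicit Types t y : R.

Lemma expr_subr1_ge y m : 0 <= y <= 1 -> 1 - m%:R * y <= (1 - y) ^+ m.
Proof.
move=> /andP[y0 y1]; elim: m => [|m IH]; first by rewrite mul0r subr0 expr0.
rewrite exprS (@le_trans _ _ ((1 - y) * (1 - m%:R * y)))//.
  rewrite -natr1; have : 0 <= m%:R * y ^+ 2 by rewrite mulr_ge0// sqr_ge0.
  nra.
by rewrite ler_wpM2l// subr_ge0.
Qed.

(** Chains 1 - y <= e^(-y) with e^(my) >= 1 + my; it is the upper companion of Bernoulli's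
    inequality above. *)
Lemma expr_subr1_le y m : 0 <= y <= 1 -> (1 - y) ^+ m <= (1 + m%:R * y)^-1.
Proof.
move=> /andP[y0 y1]; rewrite (@le_trans _ _ (expR (- (m%:R * y))))//.
  rewrite -mulrN expRM_natl lerXn2r ?nnegrE ?subr_ge0 ?expR_ge0//.
  exact: expR_ge1Dx.
rewrite expRN lef_pV2 ?posrE ?expR_gt0//; first exact: expR_ge1Dx.
by rewrite ltr_wpDr// mulr_ge0.
Qed.

(** With s the square root of t, one factor s^n keeps n s^n bounded and the other still tends to
    0. *)
Lemma cvg_nat_mul_expr t : 0 <= t < 1 -> n%:R * t ^+ n @[n --> \oo] --> (0 : R).
Proof.
move=> /andP[t0 t1]; have [->|tn0] := eqVneq t 0.
  apply: (@cvg_trans _ ((0 : R) @[n --> \oo])); last exact: cvg_cst.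
  apply: near_eq_cvg; near=> n.
  by rewrite expr0n gtn_eqF ?mulr0//; near: n; exact: nbhs_infty_gt.
pose s := Num.sqrt t.
have s0 : 0 < s by rewrite sqrtr_gt0 lt_neqAle eq_sym tn0.
have s0' := ltW s0.
have s1 : s < 1 by rewrite -sqrtr1 ltr_sqrt.
have -> : t = s ^+ 2 by rewrite sqr_sqrtr.
have bound n : n%:R * s ^+ n <= (1 - s)^-1.
  have : s ^+ n <= (1 + n%:R * (1 - s))^-1.
    have := @expr_subr1_le (1 - s) n; rewrite subKr; apply.
    by rewrite subr_ge0 ltW//= lerBlDr lerDl ltW.
  have d0 : 0 < 1 + n%:R * (1 - s) by rewrite ltr_wpDr// mulr_ge0// subr_ge0 ltW.
  move=> /(ler_wpM2l (ler0n R n)) /le_trans; apply.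
  rewrite ler_pdivrMr// mulrDr mulr1 mulrCA mulVf ?subr_eq0 ?gt_eqF// mulr1.
  by rewrite lerDr invr_ge0 subr_ge0 ltW.
apply: (@squeeze_cvgr _ _ _ _ (cst 0) (fun n => (1 - s)^-1 * s ^+ n)).
- near=> n; rewrite mulr_ge0 ?exprn_ge0 ?sqr_ge0//=.
  by rewrite -exprM mulnC exprM expr2 mulrA ler_wpM2r ?bound// exprn_ge0//.
- exact: cvg_cst.
- rewrite -[X in _ --> X](mulr0 (1 - s)^-1); apply: cvgM; first exact: cvg_cst.
  have /cvg_expr : `|s| < 1 by rewrite ger0_norm// ltW.
  exact.
Unshelve. all: by end_near. Qed.

(* [n * 2 ^ n * t ^ n = n * (2 * t) ^ n] tends to [0] if [t < 2^-1], and is at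
   least [n] otherwise. *)
Definition threshold n t : R := (1 - t ^+ n) ^+ (n * 2 ^ n).

Lemma threshold01 t : 0 <= t <= 1 -> forall n, 0 <= threshold n t <= 1.
Proof.
move=> /andP[t0 t1] n; have tn1 : t ^+ n <= 1 by rewrite exprn_ile1.
have tn0 : 0 <= t ^+ n by rewrite exprn_ge0.
by rewrite exprn_ge0 ?subr_ge0//= exprn_ile1 ?subr_ge0// lerBlDr lerDl.
Qed.

(** Bernoulli's inequality squeezes the value to 1 below one half; from one half on, the value is at
    most 1 / (1 + n). The factor [n] in the exponent decides the boundary case: without it the value
    at one half would tend to 1/e, with it the limit is the indicator of the strict inequality. *)
Lemma cvg_threshold t : 0 <= t <= 1 ->
  threshold n t @[n --> \oo] --> ((t < 2^-1)%R%:R : R).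
Proof.
move=> t01; have /andP[t0 t1] := t01.
have tn01 n : 0 <= t ^+ n <= 1 by rewrite exprn_ge0//= exprn_ile1.
have natE n : (n * 2 ^ n)%:R * t ^+ n = n%:R * (2 * t) ^+ n :> R.
  by rewrite natrM natrX exprMn mulrA.
case: ltP => t2.
  apply: (@squeeze_cvgr _ _ _ _ (fun n => 1 - n%:R * (2 * t) ^+ n) (cst 1)).
  - near=> n; have /andP[_ ->] := threshold01 t01 n; rewrite andbT -natE.
    exact: expr_subr1_ge.
  - rewrite -[X in _ --> X]subr0; apply: cvgB; first exact: cvg_cst.
    by apply: cvg_nat_mul_expr; apply/andP; split; lra.
  - exact: cvg_cst.
apply: (@squeeze_cvgr _ _ _ _ (cst 0) harmonic).
- near=> n; have /andP[-> _] /= := threshold01 t01 n.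
  apply: (le_trans (expr_subr1_le _ (tn01 n))).
  rewrite natE lef_pV2 ?posrE ?ltr0n//; last first.
    by rewrite ltr_wpDr// mulr_ge0// exprn_ge0// mulr_ge0.
  rewrite -natr1 addrC lerD2l ler_peMr// exprn_ege1//.
  lra.
- exact: cvg_cst.
- exact: cvg_harmonic.
Unshelve. all: by end_near. Qed.

End threshold.

(** * The Gaussian kernel is characteristic *)

Definition gauss_kernel (R : realType) (x y : R) : R := expR (- (x - y) ^+ 2).

Section gaussian_mmd.
Context d (T : measurableType d) (R : realType) (P : probability T R).
Variables (A B : T -> R).
Hypotheses (bA : bmfun A) (bB : bmfun B).
Implicit Types x y : R.

Definition mmd : R := \int[P]_u \int[P]_v
  (gauss_kernel (A u) (A v) - gauss_kernel (A u) (B v)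
   - gauss_kernel (B u) (A v) + gauss_kernel (B u) (B v)).

Let w x := expR (- x ^+ 2).

(** Up to the factor sqrt(2^j / j!), the difference of the [j]-th coordinates of [A u] and [B u]
    under the feature map of the Gaussian kernel. *)
Let phi j u := A u ^+ j * w (A u) - B u ^+ j * w (B u).

Let bphi j : bmfun (phi j). Proof. by rewrite /phi /w; bm. Qed.

Let ksum n x y := w x * w y * exp_sum n (2 * (x * y)).

Let ksumE n x y :
  ksum n x y = \sum_(j < n) 2 ^+ j / j`!%:R * (x ^+ j * w x) * (y ^+ j * w y).
Proof.
rewrite /ksum mulr_sumr; apply: eq_bigr => j _.
by rewrite !exprMn; ring.
Qed.

Let hsum n u v := \sum_(j < n) 2 ^+ j / j`!%:R * phi j u * phi j v.

Let hsumE n u v : hsum n u v = ksum n (A u) (A v) - ksum n (A u) (B v)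
  - ksum n (B u) (A v) + ksum n (B u) (B v).
Proof.
rewrite !ksumE -!sumrB -big_split/=; apply: eq_bigr => j _.
by rewrite /phi; ring.
Qed.

Let moment j := \int[P]_u phi j u.

Let Rintegral_hsum n :
  \int[P]_u \int[P]_v hsum n u v = \sum_(j < n) 2 ^+ j / j`!%:R * moment j ^+ 2.
Proof.
transitivity (\int[P]_u \sum_(j < n) 2 ^+ j / j`!%:R * moment j * phi j u).
  apply: eq_Rintegral => u _; rewrite Rintegral_sum_bm; last by move=> j; bm.
  apply: eq_bigr => j _.
  by rewrite RintegralZl_bm// -/(moment j); ring.
rewrite Rintegral_sum_bm; last by move=> j; bm.
apply: eq_bigr => j _.
by rewrite RintegralZl_bm// -/(moment j); ring.
Qed.

Let bmfun2 (F G : T -> R) : bmfun F -> bmfun G ->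
  bmfun (uncurry (fun u v => gauss_kernel (F u) (G v))).
Proof.
move=> bF bG.
have bF1 : bmfun (fun z : T * T => F z.1) by exact: (bmfun_comp measurable_fst bF).
have bG2 : bmfun (fun z : T * T => G z.2) by exact: (bmfun_comp measurable_snd bG).
rewrite (_ : uncurry _ = (fun z => expR (- (F z.1 - G z.2) ^+ 2))); last first.
  by apply/funext => -[].
by bm.
Qed.

(* Since [e^(-(x-y)^2) = e^(-x^2) e^(-y^2) \sum_j 2^j/j! x^j y^j], [mmd] is the
   sum over [j] of the left-hand sides. *)
Lemma mmd_moment_le j : 2 ^+ j / j`!%:R * moment j ^+ 2 <= mmd.
Proof.
have [_ [a aA]] := bA; have [_ [b bB']] := bB.
pose c := Num.max a b.
have Ac u : `|A u| <= c by rewrite le_max aA.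
have Bc u : `|B u| <= c by rewrite le_max bB' orbT.
apply/ler_addgt0Pr => e e0.
have c0 : 0 <= 2 * (c * c) by rewrite mulr_ge0// -expr2 sqr_ge0.
(* One quarter of [e] for each of the four kernel terms of [mmd]. The weights [w x] and [w y] are at
   most 1, so only the tail of the series at 2xy has to be small. *)
have e4 : 0 < e / 4 by rewrite divr_gt0.
near \oo => n.
have kn x y : `|x| <= c -> `|y| <= c -> `|gauss_kernel x y - ksum n x y| <= e / 4.
  move=> xc yc.
  have -> : gauss_kernel x y = w x * w y * expR (2 * (x * y)).
    by rewrite /gauss_kernel /w -!expRD; congr expR; ring.
  rewrite /ksum -mulrBr normrM -[leRHS]mul1r ler_pM//.
    by rewrite ger0_norm ?mulr_ge0 ?expR_ge0// mulr_ile1 ?expR_ge0// -expR0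
      ler_expR oppr_le0 sqr_ge0.
  have : `|2 * (x * y)| <= 2 * (c * c).
    by rewrite !normrM (ger0_norm (ler0n R 2)) ler_wpM2l// ler_pM.
  by move: (2 * (x * y)); near: n; exact: exp_sum_unif.
have jn : (j < n)%N by near: n; exact: nbhs_infty_gt.
have : 2 ^+ j / j`!%:R * moment j ^+ 2 <= \int[P]_u \int[P]_v hsum n u v.
  rewrite Rintegral_hsum (bigD1 (Ordinal jn))//= lerDl sumr_ge0// => i _.
  by rewrite mulr_ge0 ?sqr_ge0// divr_ge0// exprn_ge0.
move/le_trans; apply.
pose K u v := gauss_kernel (A u) (A v) - gauss_kernel (A u) (B v)
   - gauss_kernel (B u) (A v) + gauss_kernel (B u) (B v).
have bK : bmfun (uncurry K).
  rewrite (_ : uncurry K = fun z =>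
    uncurry (fun u v => gauss_kernel (A u) (A v)) z -
    uncurry (fun u v => gauss_kernel (A u) (B v)) z -
    uncurry (fun u v => gauss_kernel (B u) (A v)) z +
    uncurry (fun u v => gauss_kernel (B u) (B v)) z); last first.
    by apply/funext => -[].
  have := bmfun2 bA bA; have := bmfun2 bA bB.
  have := bmfun2 bB bA; have := bmfun2 bB bB => *.
  by bm.
have bH : bmfun (uncurry (hsum n)).
  have bp1 i : bmfun (fun z : T * T => phi i z.1).
    exact: (bmfun_comp measurable_fst (bphi i)).
  have bp2 i : bmfun (fun z : T * T => phi i z.2).
    exact: (bmfun_comp measurable_snd (bphi i)).
  rewrite (_ : uncurry _ = fun z =>
    \sum_(i < n) 2 ^+ i / i`!%:R * phi i z.1 * phi i z.2); last first.
    by apply/funext => -[].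
  by apply: bmfun_sum => i; have := bp1 i; have := bp2 i => *; bm.
have bK1 := bmfun_Rintegral P bK.
have bH1 := bmfun_Rintegral P bH.
rewrite -lerBlDl -[mmd]/(\int[P]_u \int[P]_v K u v) -RintegralB_bm//.
rewrite (le_trans (ler_norm _))//; apply: normr_Rintegral_le; first by bm.
move=> u; rewrite -RintegralB_bm; [|exact: bmfun_slice bH|exact: bmfun_slice bK].
apply: normr_Rintegral_le.
  by apply: bmfunB; [exact: bmfun_slice bH|exact: bmfun_slice bK].
move=> v; rewrite distrC hsumE /K.
have := kn _ _ (Ac u) (Ac v); have := kn _ _ (Ac u) (Bc v).
have := kn _ _ (Bc u) (Ac v); have := kn _ _ (Bc u) (Bc v).
rewrite !ler_norml => /andP[? ?] /andP[? ?] /andP[? ?] /andP[? ?].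
by apply/andP; split; lra.
Unshelve. all: by end_near. Qed.

Lemma mmd_le0_gauss_moments : mmd <= 0 -> forall j,
  \int[P]_u (A u ^+ j * expR (- A u ^+ 2)) =
  \int[P]_u (B u ^+ j * expR (- B u ^+ 2)).
Proof.
move=> mmd0 j; apply/eqP; rewrite -subr_eq0 -RintegralB_bm; [|by bm|by bm].
rewrite -[X in X == 0]/(moment j) -sqrf_eq0 eq_le sqr_ge0 andbT.
have cj : 0 < 2 ^+ j / j`!%:R :> R.
  by rewrite divr_gt0 ?exprn_gt0// ltr0n fact_gt0.
by rewrite -(pmulr_rle0 _ cj) (le_trans (mmd_moment_le j)).
Qed.

End gaussian_mmd.

(** * Bounded laws are determined by their moments *)

Section gaussian_mmd_characteristic.
Context d (T : measurableType d) (R : realType) (P : probability T R).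

(* The partial sums of [e^(A^2)] cancel the Gaussian weight. *)
Lemma cvg_gauss_moment (A : T -> R) j : bmfun A ->
  \sum_(k < n) (k`!%:R)^-1 *
    \int[P]_u (A u ^+ (j + k.*2) * expR (- A u ^+ 2)) @[n --> \oo]
  --> \int[P]_u A u ^+ j.
Proof.
move=> bA.
pose F n u := A u ^+ j * expR (- A u ^+ 2) * exp_sum n (A u ^+ 2).
have bF n : bmfun (F n).
  by apply: bmfunM; [bm|apply: bmfun_sum => i; bm].
have FE n : \int[P]_u F n u = \sum_(k < n) (k`!%:R)^-1 *
    \int[P]_u (A u ^+ (j + k.*2) * expR (- A u ^+ 2)).
  transitivity (\int[P]_u \sum_(k < n) (k`!%:R)^-1 *
      (A u ^+ (j + k.*2) * expR (- A u ^+ 2))).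
    apply: eq_Rintegral => u _; rewrite /F mulr_sumr; apply: eq_bigr => k _.
    by rewrite exprD -mul2n exprM; ring.
  rewrite Rintegral_sum_bm; last by move=> i; bm.
  by apply: eq_bigr => k _; rewrite RintegralZl_bm//; bm.
rewrite -(funext FE); have [_ [a aA]] := bA.
(* The partial sums of e^(A^2) stay between 0 and their limit, so times the Gaussian weight they are
   at most 1, and only [A u ^+ j] is left to bound. *)
apply: (@cvg_Rintegral_bm _ _ _ _ _ _ (a ^+ j)) => //.
- by bm.
- move=> n u; rewrite /F -mulrA normrM normrX -[leRHS]mulr1 ler_pM//.
    by rewrite lerXn2r ?nnegrE// (le_trans _ (aA u)).
  have e0 : 0 <= exp_sum n (A u ^+ 2).
    by apply: sumr_ge0 => i _; rewrite divr_ge0// exprn_ge0// sqr_ge0.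
  rewrite ger0_norm ?mulr_ge0 ?expR_ge0//.
  rewrite expRN mulrC ler_pdivrMr ?expR_gt0// mul1r.
  exact/exp_sum_le/sqr_ge0.
- move=> u; rewrite /F.
  rewrite [X in _ --> X](_ : _ =
      A u ^+ j * expR (- A u ^+ 2) * expR (A u ^+ 2)); last first.
    by rewrite -mulrA -expRD addNr expR0 mulr1.
  by apply: cvgM; [exact: cvg_cst|exact: cvg_exp_sum].
Qed.

Variables (A B : T -> R).
Hypotheses (bA : bmfun A) (bB : bmfun B).
Hypothesis AB : forall j, \int[P]_u A u ^+ j = \int[P]_u B u ^+ j.

Let Rintegral_poly (p : {poly R}) : \int[P]_u p.[A u] = \int[P]_u p.[B u].
Proof.
have E (C : T -> R) : bmfun C ->
    \int[P]_u p.[C u] = \sum_(i < size p) p`_i * \int[P]_u C u ^+ i.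
  move=> bC; under eq_Rintegral do rewrite horner_coef.
  rewrite Rintegral_sum_bm; last by move=> i; bm.
  by apply: eq_bigr => i _; rewrite RintegralZl_bm//; bm.
by rewrite !E//; apply: eq_bigr => i _; rewrite AB.
Qed.

(** An affine [q] carries the values of [A] and [B] into [0, 1] and [a] to one half. The polynomials
    [threshold n] composed with [q] then converge boundedly to the indicator of the half-line, and
    equal moments give them equal integrals under both laws. *)
Lemma eq_moments_cdf (a : R) :
  P (A @^-1` `]-oo, a[%classic) = P (B @^-1` `]-oo, a[%classic).
Proof.
have [mA [K KA]] := bA; have [mB [L LB]] := bB.
(* Large enough that [A - a] and [B - a] stay within 2c, so that slope 1/(4c) moves [q] by at most
   one half. The summand 1 makes [c] positive; the bounds [K] and [L] carry no sign, hence the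
   absolute values. *)
pose c : R := 1 + `|a| + `|K| + `|L|.
have c0 : 0 < c.
  rewrite /c; have := normr_ge0 a; have := normr_ge0 K.
  by have := normr_ge0 L; lra.
have Ac u : `|A u - a| <= 2 * c.
  rewrite (le_trans (ler_normB _ _))// /c; have := KA u; have := ler_norm K.
  by have := normr_ge0 a; have := normr_ge0 K; have := normr_ge0 L; lra.
have Bc u : `|B u - a| <= 2 * c.
  rewrite (le_trans (ler_normB _ _))// /c; have := LB u; have := ler_norm L.
  by have := normr_ge0 a; have := normr_ge0 K; have := normr_ge0 L; lra.
pose q : {poly R} := 2^-1%:P + (4 * c)^-1 *: ('X - a%:P).
have qE x : q.[x] = 2^-1 + (x - a) / (4 * c).
  by rewrite /q !hornerE mulrC.
have q01 x : `|x - a| <= 2 * c -> 0 <= q.[x] <= 1.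
  have c40 : 0 < 4 * c by rewrite mulr_gt0.
  rewrite qE ler_norml => /andP[lo hi].
  have : - (2^-1) <= (x - a) / (4 * c) by rewrite ler_pdivlMr//; lra.
  have : (x - a) / (4 * c) <= 2^-1 by rewrite ler_pdivrMr//; lra.
  by move=> ? ?; apply/andP; split; lra.
have q2 x : (q.[x] < 2^-1) = (x < a).
  by rewrite qE gtrDl pmulr_llt0 ?invr_gt0 ?mulr_gt0// subr_lt0.
have memE (C : T -> R) u : (u \in C @^-1` `]-oo, a[%classic) = (C u < a).
  by apply/idP/idP; rewrite inE/= in_itv.
have main (C : T -> R) : bmfun C -> (forall u, `|C u - a| <= 2 * c) ->
  \int[P]_u ((1 - q ^+ n) ^+ (n * 2 ^ n)).[C u] @[n --> \oo] -->
  fine (P (C @^-1` `]-oo, a[%classic)).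
  move=> bC Cc; have [mC _] := bC.
  have mCa : measurable (C @^-1` `]-oo, a[%classic).
    by rewrite -[X in measurable X]setTI; apply: mC => //; exact: measurable_itv.
  have -> : fine (P (C @^-1` `]-oo, a[%classic)) = \int[P]_u ((C u < a)%R%:R).
    rewrite -[X in P X]setIT -integral_indic//; congr fine.
    by apply: eq_integral => u _; rewrite indicE memE.
  have thE n u : ((1 - q ^+ n) ^+ (n * 2 ^ n)).[C u] = threshold n q.[C u].
    by rewrite /threshold !hornerE.
  apply: (@cvg_Rintegral_bm _ _ _ _ _ _ 1).
  - move=> n; under eq_fun do rewrite thE /threshold qE.
    by bm.
  - split; last by exists 1 => u; case: (_ < _); rewrite ?normr1 ?normr0.
    rewrite (_ : (fun u => _) = \1_(C @^-1` `]-oo, a[%classic)).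
      exact: measurable_indic.
    by apply/funext => u; rewrite indicE memE.
  - move=> n u; rewrite thE.
    by have /andP[? ?] := threshold01 (q01 _ (Cc u)) n; rewrite ger0_norm.
  - move=> u; rewrite -q2; under eq_fun do rewrite thE.
    exact: cvg_threshold (q01 _ (Cc u)).
have := main _ bB Bc; under eq_fun do rewrite -Rintegral_poly.
move=> /(cvg_unique _ (main _ bA Ac)) eqf.
rewrite -[LHS]fineK ?fin_num_measure//; last first.
  by rewrite -[X in measurable X]setTI; apply: mA => //; exact: measurable_itv.
rewrite eqf// fineK// fin_num_measure//.
by rewrite -[X in measurable X]setTI; apply: mB => //; exact: measurable_itv.
Qed.

(** Open left half-lines are stable under intersection, generate the Borel sets and exhaust the
    line, so agreement on them propagates to all Borel sets. *)
Lemma eq_moments_eq_in_dist : eq_in_dist P A B.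
Proof.
have [mA _] := bA; have [mB _] := bB.
move=> S mS; rewrite /pushforward.
pose fA : {mfun T >-> R} := HB.pack A (isMeasurableFun.Build _ _ _ _ _ mA).
pose fB : {mfun T >-> R} := HB.pack B (isMeasurableFun.Build _ _ _ _ _ mB).
suff : distribution P fA S = distribution P fB S by [].
apply: (measure_unique (@RGenInftyO.G R) (fun n => `]-oo, n%:R[%classic)) => //.
- exact: RGenInftyO.measurableE.
- move=> _ _ [x ->] [y ->]; exists (Num.min x y).
  by apply/seteqP; split => z /=; rewrite !in_itv/= lt_min => /andP.
- by move=> n; exists n%:R.
- rewrite -subTset => x _; exists (Num.truncn `|x|).+1 => //=.
  by rewrite in_itv/= (le_lt_trans (ler_norm x))// truncnS_gt.
- by move=> _ [a ->]; exact: eq_moments_cdf.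
- by move=> n; rewrite ltey_eq fin_num_measure.
Qed.

End gaussian_mmd_characteristic.

Lemma mmd_gt0 d (T : measurableType d) (R : realType) (P : probability T R)
    (A B : T -> R) : bmfun A -> bmfun B -> ~ eq_in_dist P A B ->
  0 < mmd P A B.
Proof.
move=> bA bB; apply: contra_notP => /negP; rewrite -leNgt => mmd0.
apply: eq_moments_eq_in_dist => // j.
have := @cvg_gauss_moment _ _ _ P _ j bB.
under eq_fun do under eq_bigr do rewrite -(mmd_le0_gauss_moments bA bB mmd0).
move=> h; have h' := @cvg_gauss_moment _ _ _ P _ j bA.
exact: (@cvg_unique _ (@Rhausdorff R) _ _ _ _ h' h).
Qed.

(** * Conditional laws *)

Lemma bmfun_indic d (T : measurableType d) (R : realType) (A : set T) :
  measurable A -> bmfun (\1_A : T -> R).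
Proof.
move=> mA; split; first exact: measurable_indic.
by exists 1 => x; rewrite indicE; case: (_ \in _); rewrite ?normr1 ?normr0.
Qed.

Section monotone_class.
Import HBNNSimple.
Context d (T : measurableType d) (R : realType).

(** After the shift by the bound [C], [f] is a bounded increasing limit of nonnegative simple
    functions, which are finite combinations of indicators of level sets; the constant is then taken
    off by linearity. *)
Lemma bounded_monotone_class (Q : (T -> R) -> Prop) :
  (forall A, measurable A -> Q \1_A) ->
  (forall a f g, bmfun f -> bmfun g -> Q f -> Q g -> Q (fun x => a * f x + g x)) ->
  (forall (F : nat -> T -> R) f C, (forall n, bmfun (F n)) -> bmfun f ->
     (forall n x, `|F n x| <= C) -> (forall x, F n x @[n --> \oo] --> f x) ->
     (forall n, Q (F n)) -> Q f) ->
  forall f, bmfun f -> Q f.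
Proof.
move=> Q1 Qlin Qlim f bf; have [mf [C fC]] := bf.
have Q0 : Q (fun=> 0).
  by rewrite (_ : (fun=> 0) = \1_set0); [exact: Q1|rewrite indic0].
have Qsum (s : seq R) (g : T -> R) : measurable_fun setT g ->
    bmfun (fun x => \sum_(r <- s) r * \1_(g @^-1` [set r]) x) /\
    Q (fun x => \sum_(r <- s) r * \1_(g @^-1` [set r]) x).
  move=> mg; elim: s => [|r s [bs Qs]].
    rewrite (_ : (fun x => _) = (fun=> 0)); first by split => //; bm.
    by apply/funext => x; rewrite big_nil.
  have mr : measurable (g @^-1` [set r]).
    by rewrite -[X in measurable X]setTI; apply: mg.
  rewrite (_ : (fun x => _) = (fun x => r * \1_(g @^-1` [set r]) x +
      \sum_(r <- s) r * \1_(g @^-1` [set r]) x)); last first.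
    by apply/funext => x; rewrite big_cons.
  split; last by apply: Qlin => //; [exact: bmfun_indic|exact: Q1].
  by have := bmfun_indic R mr => ?; bm.
pose h x := f x + C.
have h0 x : 0 <= h x.
  by rewrite /h -lerBlDr sub0r; have := fC x; rewrite ler_norml => /andP[].
have mh : measurable_fun setT (EFin \o h).
  by apply/measurable_EFinP; apply: measurable_funD.
have hh0 x : setT x -> (0 <= (EFin \o h) x)%E by rewrite lee_fin.
pose F n := nnsfun_approx measurableT mh n.
have FQ n : bmfun (F n : T -> R) /\ Q (F n).
  have -> : (F n : T -> R) = fun x =>
      \sum_(r <- finmap.enum_fset (fset_set (range (F n)))) r * \1_(F n @^-1` [set r]) x.
    by apply/funext => x; rewrite [in LHS]fimfunE fsbig_finite.
  by apply: Qsum; exact: measurable_funPT.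
have hC x : h x <= C + C by rewrite lerD2r (le_trans (ler_norm _)).
have Qh : Q h.
  apply: (Qlim (fun n => F n : T -> R) h (C + C)).
  - by move=> n; have [] := FQ n.
  - by rewrite /h; bm.
  - move=> n x; rewrite ger0_norm ?fun_ge0// (le_trans _ (hC x))// -lee_fin.
    by rewrite /F nnsfun_approxE; exact: (le_approx n hh0 (I : setT x)).
  - move=> x; under eq_fun do rewrite /F nnsfun_approxE.
    exact: (cvg_approx hh0 (I : setT x) (ltry _)).
  - by move=> n; have [] := FQ n.
have QC : Q (cst 1) by rewrite -indicT; exact: Q1.
rewrite (_ : f = (fun x => (- C) * 1 + h x)); last first.
  by apply/funext => x; rewrite /h; ring.
by apply: Qlin => //; [bm|rewrite /h; bm].
Qed.

End monotone_class.

Section conditional_law.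
Context d (O : measurableType d) (R : realType) (P : probability O R).
Context d' (X : measurableType d') (XT : O -> X) (kappa : R.-pker X ~> O).
Hypotheses (mXT : measurable_fun setT XT) (cXT : conditional_law P XT kappa).

(** The values of [kappa] are repackaged as probabilities, so that the lemmas on integrals of
    bounded functions under a probability apply to them. *)
Let kmeas (x : X) : set O -> \bar R := kappa x.
HB.instance Definition _ x := Measure.on (kmeas x).
Let kmeas_setT x : kmeas x setT = 1%E := prob_kernel x.
HB.instance Definition _ x :=
  Measure_isProbability.Build _ _ _ (kmeas x) (kmeas_setT x).
Let kprob (x : X) : probability O R := kmeas x.

Let mpre (A : set X) : measurable A -> measurable (XT @^-1` A).
Proof. by move=> mA; rewrite -[X in measurable X]setTI; exact: mXT. Qed.

Let bmpre (A : set X) : measurable A -> bmfun (fun o => \1_A (XT o) : R).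
Proof. by move=> mA; exact: (bmfun_comp mXT (bmfun_indic R mA)). Qed.

(** For indicators this is the defining identity of [conditional_law]; the monotone class argument
    extends it. The measurability of the conditional integral travels in the same induction because
    the linear and limit steps integrate it. *)
Lemma conditional_law_integral (D : O -> R) : bmfun D ->
  bmfun (fun x => \int[kappa x]_u D u) /\
  forall A, measurable A ->
    \int[P]_o (\1_A (XT o) * D o) =
    \int[P]_o (\1_A (XT o) * \int[kappa (XT o)]_u D u).
Proof.
move: D; apply: bounded_monotone_class.
- move=> B mB.
  have E x : \int[kappa x]_u \1_B u = fine (kappa x B).
    by rewrite /Rintegral integral_indic// setIT.
  have kfin x : kappa x B \is a fin_num by exact: (fin_num_measure (kprob x)).
  split.
    split.
      under eq_fun do rewrite E.
      by apply: measurableT_comp => //; exact: measurable_kernel.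
    exists 1 => x; rewrite E ger0_norm ?fine_ge0// -lee_fin fineK//.
    exact: (probability_le1 (kprob x)).
  move=> A mA; have := cXT mA mB.
  rewrite -[X in P X]setIT -integral_indic//; last exact: measurableI (mpre mA) mB.
  rewrite [in RHS]integral_mkcond => /(congr1 fine) cAB.
  transitivity (\int[P]_o \1_(XT @^-1` A `&` B) o).
    by apply: eq_Rintegral => o _; rewrite indicI.
  rewrite [LHS]cAB; congr fine; apply: eq_integral => o _.
  have memE : (o \in XT @^-1` A) = (XT o \in A) by apply/idP/idP; rewrite !inE.
  rewrite patchE E indicE memE.
  by case: (XT o \in A); rewrite ?mul1r ?mul0r ?fineK.
- move=> a f g bf bg [bkf Qf] [bkg Qg].
  have E x : \int[kappa x]_u (a * f u + g u) =
      a * \int[kappa x]_u f u + \int[kappa x]_u g u.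
    change (\int[kprob x]_u (a * f u + g u) =
      a * \int[kprob x]_u f u + \int[kprob x]_u g u).
    by rewrite RintegralD_bm ?RintegralZl_bm//; bm.
  split; first by under eq_fun do rewrite E; bm.
  move=> A mA; under [RHS]eq_Rintegral do rewrite E.
  have bA := bmpre mA.
  have bkf' := bmfun_comp mXT bkf; have bkg' := bmfun_comp mXT bkg.
  have split (u v : O -> R) : bmfun u -> bmfun v ->
      \int[P]_o (\1_A (XT o) * (a * u o + v o)) =
      a * \int[P]_o (\1_A (XT o) * u o) + \int[P]_o (\1_A (XT o) * v o).
    move=> bu bv; rewrite -RintegralZl_bm; last by bm.
    rewrite -RintegralD_bm; [|by bm|by bm].
    by apply: eq_Rintegral => o _; ring.
  by rewrite (split _ _ bf bg) (split _ _ bkf' bkg') Qf// Qg.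
- move=> F f C bF bf FC Ff QF.
  have kcv x : \int[kappa x]_u F n u @[n --> \oo] --> \int[kappa x]_u f u.
    exact: (cvg_Rintegral_bm (P := kprob x) bF bf FC Ff).
  have bkf : bmfun (fun x => \int[kappa x]_u f u).
    split; first by apply: (measurable_fun_cvg (fun n => (QF n).1.1)) => x _; exact: kcv.
    have [_ [K fK]] := bf; exists K => x.
    exact: (normr_Rintegral_le (kprob x)).
  split => // A mA; have bA := bmpre mA.
  have bkf' := bmfun_comp mXT bkf.
  have ind1 x : `|\1_A x| <= 1 :> R.
    by rewrite indicE; case: (_ \in _); rewrite ?normr1 ?normr0.
  have c1 : \int[P]_o (\1_A (XT o) * F n o) @[n --> \oo] -->
      \int[P]_o (\1_A (XT o) * f o).
    apply: (@cvg_Rintegral_bm _ _ _ _ _ _ C).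
    + by move=> n; have := bF n => ?; bm.
    + by bm.
    + by move=> n o; rewrite normrM -[leRHS]mul1r ler_pM.
    + by move=> o; apply: cvgM; [exact: cvg_cst|exact: Ff].
  have c2 : \int[P]_o (\1_A (XT o) * \int[kappa (XT o)]_u F n u) @[n --> \oo] -->
      \int[P]_o (\1_A (XT o) * \int[kappa (XT o)]_u f u).
    apply: (@cvg_Rintegral_bm _ _ _ _ _ _ C).
    + by move=> n; have := bmfun_comp mXT (QF n).1 => ?; bm.
    + by bm.
    + move=> n o; rewrite normrM -[leRHS]mul1r ler_pM//.
      by apply: (normr_Rintegral_le (kprob (XT o))).
    + by move=> o; apply: cvgM; [exact: cvg_cst|exact: kcv].
  have FE n := (QF n).2 A mA.
  move: c1; rewrite (funext FE) => c1.
  exact: (@cvg_unique _ (@Rhausdorff R) _ _ _ _ c1 c2).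
Qed.

(** A factor depending on [XT] alone can be pulled out of the conditional expectation of [D], which
    vanishes. Indicators come from the tower identity, general factors from a second monotone class
    argument, now in [phi]. *)
Lemma conditional_mean0_orthogonal (D : O -> R) (phi : X -> R) :
  {ae P, forall o, \int[kappa (XT o)]_u D u = 0} ->
  bmfun D -> measurable_fun setT phi -> bmfun (phi \o XT) ->
  \int[P]_o (phi (XT o) * D o) = 0.
Proof.
move=> D0 bD mphi [_ [C phiC]].
have [bk kE] := conditional_law_integral bD.
have indic0 A : measurable A -> \int[P]_o (\1_A (XT o) * D o) = 0.
  move=> mA; rewrite kE// -[RHS](Rintegral_cst_prob P 0); congr fine.
  have bA := bmpre mA; have bk' := bmfun_comp mXT bk.
  apply: ae_eq_integral => //.
    apply/measurable_EFinP.
    by have [] : bmfun (fun o => \1_A (XT o) * \int[kappa (XT o)]_u D u) by bm.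
  by apply: filterS D0 => o /= -> _; rewrite mulr0.
(* Only the values of [phi] on the range of [XT] are bounded: truncate. *)
pose psi x := Num.max (- C) (Num.min C (phi x)).
have psiE o : phi (XT o) = psi (XT o).
  have := phiC o; rewrite /= ler_norml => /andP[lo hi].
  by rewrite /psi min_r// max_r.
under eq_Rintegral do rewrite psiE.
have bpsi : bmfun psi.
  split; first by apply: measurable_maxr => //; exact: measurable_minr.
  exists `|C| => x; rewrite ler_norml /psi le_max ge_max.
  rewrite lerN2 ler_norm/= ge_min ler_norm/= andbT.
  by rewrite -normrN ler_norm.
move: psi bpsi {psiE}; apply: bounded_monotone_class => //.
- move=> a f g bf bg Qf Qg.
  have bf' := bmfun_comp mXT bf; have bg' := bmfun_comp mXT bg.
  transitivity (\int[P]_o (a * (f (XT o) * D o) + g (XT o) * D o)).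
    by apply: eq_Rintegral => o _; ring.
  rewrite RintegralD_bm; [|by bm|by bm].
  by rewrite RintegralZl_bm ?Qf ?Qg ?mulr0 ?addr0//; bm.
- move=> F f K bF bf FK Ff QF; have [_ [L DL]] := bD.
  have : \int[P]_o (F n (XT o) * D o) @[n --> \oo] --> \int[P]_o (f (XT o) * D o).
    have bf' := bmfun_comp mXT bf.
    apply: (@cvg_Rintegral_bm _ _ _ _ _ _ (K * L)).
    + by move=> n; have := bmfun_comp mXT (bF n) => ?; bm.
    + by bm.
    + by move=> n o; rewrite normrM ler_pM.
    + by move=> o; apply: cvgM; [exact: Ff|exact: cvg_cst].
  rewrite (funext QF) => c0.
  by apply: (@cvg_unique _ (@Rhausdorff R) _ _ _ _ c0); exact: cvg_cst.
Qed.

End conditional_law.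

(** * The kernel [Gamma] *)

Ltac mf := repeat first [assumption | apply: measurable_cst
  | apply: measurable_funB | apply: measurable_funD | apply: measurable_funM
  | apply: measurable_funN | apply: measurable_funX
  | apply: (measurableT_comp (@measurable_expR _))].

Section gamma_kernel.
Context d (O : measurableType d) (R : realType).
Variables (M : set (probability O R)) (P0 : probability O R).
Implicit Types (T U : mapping O R) (P : probability O R).

Lemma bmfun_map_val T P : in_S M P0 T -> M P -> bmfun (map_val T P).
Proof.
move=> hT MP; split; first exact: measurableT_comp (S1_meas hT MP) (S_X hT).
have [b _ bT] := S1_bounded hT; exists b => o.
by have := bT _ MP o; rewrite in_itv/= ler_norml.
Qed.

Lemma bmfun_map_D T P : in_S M P0 T -> M P -> bmfun (map_D T P).
Proof.
move=> hT MP; split; first exact: S3_D_meas hT _ MP.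
by have [C CD] := S3_D_bounded hT; exists C => o; exact: CD.
Qed.

Lemma bmfun_Gamma2 T U P : in_S M P0 T -> in_S M P0 U -> M P ->
  bmfun (uncurry (Gamma2 T U P)).
Proof.
move=> hT hU MP.
have bT := bmfun_comp measurable_fst (bmfun_map_val hT MP).
have bU := bmfun_comp measurable_snd (bmfun_map_val hU MP).
have bDT := bmfun_comp measurable_fst (bmfun_map_D hT MP).
have bDU := bmfun_comp measurable_snd (bmfun_map_D hU MP).
rewrite (_ : uncurry _ = fun z : O * O =>
  (2 * (map_val T P z.1 - map_val U P z.2) * (map_D U P z.2 - map_D T P z.1) + 1
   - (4 * (map_val T P z.1 - map_val U P z.2) ^+ 2 - 2) * map_D T P z.1 * map_D U P z.2)
  * expR (- (map_val T P z.1 - map_val U P z.2) ^+ 2)).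
  by bm.
by apply/funext => -[].
Qed.

Lemma bmfun_Gamma T U P : in_S M P0 T -> in_S M P0 U -> M P ->
  bmfun (uncurry (Gamma T U P)).
Proof.
move=> hT hU MP; rewrite (_ : uncurry _ = fun z =>
  uncurry (Gamma2 T T P) z - uncurry (Gamma2 T U P) z
  - uncurry (Gamma2 U T P) z + uncurry (Gamma2 U U P) z); last first.
  by apply/funext => -[].
have := bmfun_Gamma2 hT hT MP; have := bmfun_Gamma2 hT hU MP.
have := bmfun_Gamma2 hU hT MP; have := bmfun_Gamma2 hU hU MP => *.
by bm.
Qed.

Lemma Gamma2C T U P o1 o2 : Gamma2 T U P o1 o2 = Gamma2 U T P o2 o1.
Proof.
rewrite /Gamma2 -(opprB (map_val T P o1)) sqrrN; congr (_ * _).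
by ring.
Qed.

(** Exchanging the points turns each pure term into itself and swaps the two mixed terms, which
    enter [Gamma] with the same sign. *)
Lemma GammaC T U P o1 o2 : Gamma T U P o1 o2 = Gamma T U P o2 o1.
Proof.
rewrite /Gamma (Gamma2C T T P o1 o2) (Gamma2C T U P o1 o2).
by rewrite (Gamma2C U T P o1 o2) (Gamma2C U U P o1 o2); ring.
Qed.

Hypothesis M_P0 : M P0.

Lemma map_D_orthogonal T (phi : map_space T -> R) : in_S M P0 T ->
  measurable_fun setT phi -> bmfun (phi \o map_X T) ->
  \int[P0]_o (phi (map_X T o) * map_D T P0 o) = 0.
Proof.
move=> hT; apply: (conditional_mean0_orthogonal (kappa := map_cond T P0)).
- exact: S_X hT.
- exact: S_cond hT _ M_P0.
- exact: S3_D_mean0 hT _ M_P0.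
- exact: bmfun_map_D hT M_P0.
Qed.

(* Each term of [Gamma2] with a factor [D^T(o1)] or [D^U(o2)] integrates to [0]:
   the remaining factor depends on that coordinate only through [x^T], or [x^U]. *)
Lemma Rintegral_Gamma2 T U : in_S M P0 T -> in_S M P0 U ->
  \int[P0]_u \int[P0]_v Gamma2 T U P0 u v =
  \int[P0]_u \int[P0]_v gauss_kernel (map_val T P0 u) (map_val U P0 v).
Proof.
move=> hT hU.
have bT := bmfun_map_val hT M_P0; have bU := bmfun_map_val hU M_P0.
have bDT := bmfun_map_D hT M_P0; have bDU := bmfun_map_D hU M_P0.
pose t := map_val T P0; pose s := map_val U P0.
pose k u v := gauss_kernel (t u) (s v).
(* The full coefficient of D^T(u), the product term D^T D^U included; D^U(v) is a constant once [v]
   is fixed. Only the term linear in D^U is left for [b2]. *)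
pose beta u v := - (2 * (t u - s v) + (4 * (t u - s v) ^+ 2 - 2) * map_D U P0 v) * k u v.
pose b1 u v := beta u v * map_D T P0 u.
pose b2 u v := 2 * (t u - s v) * k u v * map_D U P0 v.
have bT1 := bmfun_comp measurable_fst bT.
have bU2 := bmfun_comp measurable_snd bU.
have bDT1 := bmfun_comp measurable_fst bDT.
have bDU2 := bmfun_comp measurable_snd bDU.
have bk : bmfun (uncurry k).
  rewrite (_ : uncurry _ = fun z : O * O => expR (- (t z.1 - s z.2) ^+ 2)).
    by bm.
  by apply/funext => -[].
have bb1 : bmfun (uncurry b1).
  rewrite (_ : uncurry _ = fun z : O * O => - (2 * (t z.1 - s z.2) +
    (4 * (t z.1 - s z.2) ^+ 2 - 2) * map_D U P0 z.2) *
    expR (- (t z.1 - s z.2) ^+ 2) * map_D T P0 z.1); first by bm.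
  by apply/funext => -[].
have bb2 : bmfun (uncurry b2).
  rewrite (_ : uncurry _ = fun z : O * O => 2 * (t z.1 - s z.2) *
    expR (- (t z.1 - s z.2) ^+ 2) * map_D U P0 z.2); first by bm.
  by apply/funext => -[].
have Rb1 : \int[P0]_u \int[P0]_v b1 u v = 0.
  (* The gradient in [b1] sits at [u], so the integral over [u] must come first; in [b2] it sits at
     [v], already the inner variable. *)
  rewrite Rintegral_swap// -[RHS](Rintegral_cst_prob P0 0).
  apply: eq_Rintegral => v _.
  pose phi x := - (2 * (@map_fun _ _ _ T P0 x - s v) +
    (4 * (@map_fun _ _ _ T P0 x - s v) ^+ 2 - 2) * map_D U P0 v) *
    expR (- (@map_fun _ _ _ T P0 x - s v) ^+ 2).
  have mT := S1_meas hT M_P0.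
  apply: (@map_D_orthogonal T phi) => //; last first.
    by rewrite (_ : phi \o _ = fun u => - (2 * (t u - s v) +
      (4 * (t u - s v) ^+ 2 - 2) * map_D U P0 v) *
      expR (- (t u - s v) ^+ 2))//; bm.
  by rewrite /phi; mf.
have Rb2 : \int[P0]_u \int[P0]_v b2 u v = 0.
  rewrite -[RHS](Rintegral_cst_prob P0 0); apply: eq_Rintegral => u _.
  pose phi y := 2 * (t u - @map_fun _ _ _ U P0 y) *
    expR (- (t u - @map_fun _ _ _ U P0 y) ^+ 2).
  have mU := S1_meas hU M_P0.
  apply: (@map_D_orthogonal U phi) => //; last first.
    by rewrite (_ : phi \o _ = fun v => 2 * (t u - s v) *
      expR (- (t u - s v) ^+ 2))//; bm.
  by rewrite /phi; mf.
transitivity (\int[P0]_u \int[P0]_v (k u v + (b1 u v + b2 u v))).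
  apply: eq_Rintegral => u _; apply: eq_Rintegral => v _.
  by rewrite /b1 /b2 /beta /k /gauss_kernel /Gamma2 /t /s; ring.
have b12 u : bmfun (b1 u) /\ bmfun (b2 u).
  by split; apply: bmfun_slice.
transitivity (\int[P0]_u ((\int[P0]_v k u v) +
   (\int[P0]_v b1 u v + \int[P0]_v b2 u v))).
  apply: eq_Rintegral => u _; have [? ?] := b12 u.
  rewrite RintegralD_bm; [|exact: bmfun_slice bk|by bm].
  by rewrite RintegralD_bm.
have i1 := bmfun_Rintegral P0 bk.
have i2 := bmfun_Rintegral P0 bb1; have i3 := bmfun_Rintegral P0 bb2.
rewrite RintegralD_bm; [|by bm|by bm].
by rewrite RintegralD_bm// Rb1 Rb2 !addr0.
Qed.

Lemma Rintegral_Gamma T U : in_S M P0 T -> in_S M P0 U ->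
  \int[P0]_u \int[P0]_v Gamma T U P0 u v = mmd P0 (map_val T P0) (map_val U P0).
Proof.
move=> hT hU.
have split4 (a b c e : O -> O -> R) : bmfun (uncurry a) -> bmfun (uncurry b) ->
    bmfun (uncurry c) -> bmfun (uncurry e) ->
    \int[P0]_u \int[P0]_v (a u v - b u v - c u v + e u v) =
    \int[P0]_u \int[P0]_v a u v - \int[P0]_u \int[P0]_v b u v
    - \int[P0]_u \int[P0]_v c u v + \int[P0]_u \int[P0]_v e u v.
  move=> ba bb bc be.
  have i1 := bmfun_Rintegral P0 ba; have i2 := bmfun_Rintegral P0 bb.
  have i3 := bmfun_Rintegral P0 bc; have i4 := bmfun_Rintegral P0 be.
  rewrite -RintegralB_bm// -RintegralB_bm; [|by bm|by bm].
  rewrite -RintegralD_bm; [|by bm|by bm].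
  apply: eq_Rintegral => u _.
  have j1 := bmfun_slice u ba; have j2 := bmfun_slice u bb.
  have j3 := bmfun_slice u bc; have j4 := bmfun_slice u be.
  rewrite RintegralD_bm; [|by bm|by bm].
  rewrite RintegralB_bm; [|by bm|by bm].
  by rewrite RintegralB_bm.
have bg (V W : mapping O R) : in_S M P0 V -> in_S M P0 W ->
    bmfun (uncurry (fun u v => gauss_kernel (map_val V P0 u) (map_val W P0 v))).
  move=> hV hW.
  have ? := bmfun_comp measurable_fst (bmfun_map_val hV M_P0).
  have ? := bmfun_comp measurable_snd (bmfun_map_val hW M_P0).
  rewrite (_ : uncurry _ = fun z : O * O =>
    expR (- (map_val V P0 z.1 - map_val W P0 z.2) ^+ 2)); first by bm.
  by apply/funext => -[].
rewrite /Gamma split4; [|exact: bmfun_Gamma2..].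
rewrite /mmd split4; [|exact: (bg T T)|exact: (bg T U)|exact: (bg U T)|exact: (bg U U)].
by rewrite (Rintegral_Gamma2 hT hT) (Rintegral_Gamma2 hT hU)
  (Rintegral_Gamma2 hU hT) (Rintegral_Gamma2 hU hU).
Qed.

End gamma_kernel.

(** * Outer probabilities and the uniform norm *)

Section vanishing_outer_probability.
Context d (O : measurableType d) (R : realType) (P : probability O R).
Implicit Types (E F : forall n, set (n.-tuple O)).

(** [little_oP] at a fixed level and [wp_to_1] (for the complement) unfold to this form, so the
    hypotheses can be combined by unions. *)
Definition negl E := (((iid_law P n)^*)%mu (E n)) @[n --> \oo] --> 0%E.

Lemma neglP E : negl E <-> forall e : R, 0 < e ->
  \forall n \near \oo, (((iid_law P n)^*)%mu (E n) <= e%:E)%E.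
Proof.
split=> [E0 e e0|E0].
  have : nbhs 0%E [set x : \bar R | (x < e%:E)%E].
    by apply: open_nbhs_nbhs; split; [exact: open_ereal_lt_ereal|rewrite /= lte_fin].
  move=> /E0 [N _ NE]; exists N => // n /NE /=; exact: ltW.
have ge0 n : (0 <= ((iid_law P n)^*)%mu (E n))%E by exact: mu_ext_ge0.
apply/fine_cvgP; split.
  have := E0 1 ltr01; apply: filterS => n nE.
  by rewrite ge0_fin_numE// (le_lt_trans nE)// ltry.
apply/cvgrPdist_le => e e0; have := E0 e e0; apply: filterS => n nE.
rewrite sub0r normrN ger0_norm; last exact: fine_ge0.
by rewrite -lee_fin fineK// ge0_fin_numE// (le_lt_trans nE)// ltry.
Qed.

Lemma neglU E F : negl E -> negl F -> negl (fun n => E n `|` F n).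
Proof.
move=> /neglP nE /neglP nF; apply/neglP => e e0.
have e2 : 0 < e / 2 by rewrite divr_gt0.
have := nF _ e2; have := nE _ e2; apply: filterS2 => n En Fn.
rewrite (le_trans (outer_measureU2 _ _ _))// (splitr e) EFinD.
exact: leeD.
Qed.

Lemma neglS E F : (\forall n \near \oo, E n `<=` F n) -> negl F -> negl E.
Proof.
move=> EF /neglP nF; apply/neglP => e e0.
have := nF _ e0; move: EF; apply: filterS2 => n EFn.
by apply: le_trans; exact: le_mu_ext.
Qed.

Lemma negl_setC_cvg1 E : (forall n, measurable (E n)) ->
  negl (fun n => ~` E n) -> iid_law P n (E n) @[n --> \oo] --> 1%E.
Proof.
move=> mE nE; have EE n : iid_law P n (E n) =
    (1 - ((iid_law P n)^*)%mu (~` E n))%E.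
  rewrite measurable_mu_extE; last exact: (measurableC (mE n)).
  by rewrite -{1}(setCK (E n)) (probability_setC _ (measurableC (mE n))).
rewrite (funext EE); have : (1 - ((iid_law P n)^*)%mu (~` E n) @[n --> \oo] -->
    (1 - 0 : \bar R))%E by apply: cvgeB => //; exact: cvg_cst.
by rewrite sube0.
Qed.

End vanishing_outer_probability.

(** The integral of a nonnegative function is a supremum over the simple functions below it, which
    is monotone for arbitrary functions. It is applied below to [cutoff], whose measurability is
    never established. *)
Lemma ge0_le_integral_nomeas d (T : measurableType d) (R : realType)
    (mu : {measure set T -> \bar R}) (D : set T) (f g : T -> \bar R) :
  (forall x, D x -> (0 <= f x <= g x)%E) ->
  (\int[mu]_(x in D) f x <= \int[mu]_(x in D) g x)%E.
Proof.
move=> fg; rewrite !ge0_integralE.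
- apply: ge_ereal_sup => _ [h /= hf <-]; apply: ereal_sup_ubound; exists h => // x.
  rewrite (le_trans (hf x))// /patch; case: ifPn => // /set_mem Dx.
  by have /andP[] := fg _ Dx.
- by move=> x /fg /andP[]; exact: le_trans.
- by move=> x /fg /andP[].
Qed.

Lemma markov_ge1 d (T : measurableType d) (R : realType) (Q : probability T R)
    (U : T -> R) : Q.-integrable setT (EFin \o U) -> (forall w, 0 <= U w) ->
  (Q [set w | (1 <= U w)%R] <= 'E_Q[U])%E.
Proof.
move=> /integrableP[/measurable_EFinP mU _] U0.
have mB : measurable [set w | 1 <= U w].
  rewrite (_ : [set w | _] = U @^-1` `[1, +oo[%classic).
    by rewrite -[X in measurable X]setTI; apply: mU => //; exact: measurable_itv.
  by apply/seteqP; split => w /=; rewrite in_itv/= andbT.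
rewrite -[X in (Q X <= _)%E]setTI setIC -integral_indic// unlock.
apply: ge0_le_integral_nomeas => w _; rewrite !lee_fin indicE ler0n/=.
by have [/set_mem //|_] := boolP (w \in _).
Qed.

(** * Balls and a continuous cutoff for the uniform norm *)

Section uniform_norm.
Context d (O : measurableType d) (R : realType) (F : set (O -> R)).
Local Notation V := {uniform` F -> R}.
Implicit Types (z h : V).

Definition unif_norm z : R := sup [set `|z f| | f in F].

Lemma unif_norm_ub z f : ellinfty F z -> F f -> `|z f| <= unif_norm z.
Proof.
move=> [C zC] Ff; apply: sup_upper_bound; last by exists f.
split; first by exists `|z f|, f.
by exists C => _ [g Fg <-]; exact: zC.
Qed.

Lemma unif_norm_le z C : 0 <= C -> (forall f, F f -> `|z f| <= C) ->
  unif_norm z <= C.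
Proof.
move=> C0 zC; have [[f Ff]|F0] := pselect (exists f, F f).
  apply: ge_sup; first by exists `|z f|, f.
  by move=> _ [g Fg <-]; exact: zC.
(* For an empty class the supremum is over the empty set, where [sup] takes the value 0. *)
rewrite /unif_norm; have -> : [set `|z f| | f in F] = set0; last by rewrite sup0.
by apply/seteqP; split => // x [f Ff _]; apply: F0; exists f.
Qed.

Lemma unif_norm_ge0 z : ellinfty F z -> 0 <= unif_norm z.
Proof.
move=> lz; have [[f Ff]|F0] := pselect (exists f, F f).
  exact: le_trans (unif_norm_ub lz Ff).
rewrite /unif_norm; have -> : [set `|z f| | f in F] = set0; last by rewrite sup0.
by apply/seteqP; split => // x [f Ff _]; apply: F0; exists f.
Qed.

Lemma unif_nbhs z (e : R) : 0 < e ->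
  nbhs z [set h : V | forall f, F f -> `|z f - h f| < e].
Proof.
move=> e0; apply/uniform_nbhs.
exists [set xy : R * R | ball xy.1 e xy.2]; split => //.
exact: (entourage_ball R (PosNum e0)).
Qed.

Lemma ellinfty_near z h (e : R) : ellinfty F z ->
  (forall f, F f -> `|z f - h f| < e) -> ellinfty F h.
Proof.
move=> [C zC] zh; exists (C + e) => f Ff.
rewrite -[h f](subrK (z f)) addrC (le_trans (ler_normD _ _))// lerD ?zC//.
by rewrite distrC ltW// zh.
Qed.

Lemma unif_norm_near z h (e : R) : 0 < e -> ellinfty F z ->
  (forall f, F f -> `|z f - h f| < e) -> `|unif_norm z - unif_norm h| <= e.
Proof.
move=> e0 lz zh; have lh := ellinfty_near lz zh.
have hz : unif_norm h <= unif_norm z + e.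
  apply: unif_norm_le => [|f Ff]; first by rewrite addr_ge0 ?unif_norm_ge0// ltW.
  rewrite -[h f](subrK (z f)) addrC (le_trans (ler_normD _ _))// lerD ?unif_norm_ub//.
  by rewrite distrC ltW// zh.
have zh' : unif_norm z <= unif_norm h + e.
  apply: unif_norm_le => [|f Ff]; first by rewrite addr_ge0 ?unif_norm_ge0// ltW.
  rewrite -[z f](subrK (h f)) addrC (le_trans (ler_normD _ _))// lerD ?unif_norm_ub//.
  by rewrite ltW// zh.
by rewrite ler_norml; apply/andP; split; lra.
Qed.

(** The slack between [C] and [r] makes this set open; requiring only |z f| < r for each [f] would
    not. *)
Definition unif_ball (r : R) : set V :=
  [set z | exists2 C, C < r & forall f, F f -> `|z f| <= C].

Lemma unif_ball_open r : open (unif_ball r).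
Proof.
rewrite openE => z [C Cr zC]; rewrite /interior.
have e0 : 0 < (r - C) / 2 by rewrite divr_gt0// subr_gt0.
apply: filterS (unif_nbhs z e0) => h zh; exists (C + (r - C) / 2).
  by lra.
move=> f Ff; rewrite -[h f](subrK (z f)) addrC (le_trans (ler_normD _ _))//.
by rewrite lerD ?zC// distrC ltW// zh.
Qed.

Lemma bigcup_unif_ball : \bigcup_(m : nat) unif_ball m%:R = ellinfty F.
Proof.
apply/seteqP; split => [z [m _ [C _ zC]]|z [C zC]]; first by exists C.
exists (Num.truncn `|C|).+1 => //; exists C => //.
by rewrite (le_lt_trans (ler_norm C))// truncnS_gt.
Qed.

(** A ramp in the norm, 0 up to [m] and 1 from [m + 1] on: weak convergence tests bounded continuous
    functions, so it stands in for the indicator of leaving a ball. *)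
Definition cutoff (m : R) z : R := Num.min 1 (Num.max 0 (unif_norm z - m)).

Lemma cutoff01 m z : 0 <= cutoff m z <= 1.
Proof. by rewrite /cutoff le_min ler01 le_max lexx/= ge_min lexx. Qed.

Lemma cutoff_eq0 m z : 0 <= m -> unif_ball m z -> cutoff m z = 0.
Proof.
move=> m0 [C Cm zC]; have zm : unif_norm z <= m.
  by apply: unif_norm_le => // f /zC /le_trans; apply; exact: ltW.
by rewrite /cutoff max_l ?subr_le0// min_r.
Qed.

Lemma cutoff_eq1 m z f : ellinfty F z -> F f -> m + 1 <= `|z f| -> cutoff m z = 1.
Proof.
move=> lz Ff mz; rewrite /cutoff min_l// le_max lerBrDl.
by rewrite (le_trans mz) ?orbT//; exact: unif_norm_ub.
Qed.

Lemma cutoff_lip m z h e : `|unif_norm z - unif_norm h| <= e ->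
  `|cutoff m z - cutoff m h| <= e.
Proof.
rewrite /cutoff; move: (unif_norm z) (unif_norm h) => a b.
rewrite !ler_norml !minEle !maxEle => /andP[? ?].
by case: (leP 0 (a - m)) => ?; case: (leP 0 (b - m)) => ?; rewrite ?ler10;
  case: (leP 1 (a - m)) => ?; case: (leP 1 (b - m)) => ?;
  apply/andP; split; lra.
Qed.

Lemma cutoff_continuous m : {within ellinfty F, continuous (cutoff m : V -> R)}.
Proof.
apply: continuous_in_subspaceT => z /set_mem lz.
apply/(@cvgrPdist_le _ _ _ _ (nbhs_filter (z : V))) => e e0.
apply: (@filterS _ _ (nbhs_filter (z : V)) _ _ _ (unif_nbhs z e0)) => h zh.
by apply: cutoff_lip; exact: unif_norm_near.
Qed.

End uniform_norm.

(** * Empirical processes and U-statistics *)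

Section donsker_bound.
Context d (O : measurableType d) (R : realType).
Variables (P : probability O R) (F : set (O -> R)).
Local Notation V := {uniform` F -> R}.
Local Notation BV := (g_sigma_algebraType (@open V)).

Let measurable_unif_ball (r : R) : measurable (unif_ball r : set BV).
Proof. by apply: sub_sigma_algebra; exact: unif_ball_open. Qed.

Let measurable_ellinfty : measurable (ellinfty F : set BV).
Proof. by rewrite -bigcup_unif_ball; apply: bigcupT_measurable. Qed.

(** Continuity from below along the balls of integer radius, whose union is [ellinfty F]. *)
Lemma law_ellinfty_unif_ball (L : probability BV R) (e : R) :
  L (ellinfty F) = 1%E -> 0 < e ->
  exists m : nat, (L (~` (unif_ball m%:R : set V)) <= e%:E)%E.
Proof.
move=> L1 e0.
have ndB : nondecreasing_seq (fun m : nat => unif_ball m%:R : set BV).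
  move=> m n mn; apply/subsetPset => z [C Cm zC]; exists C => //.
  by rewrite (lt_le_trans Cm)// ler_nat.
have : (L \o (fun m : nat => unif_ball m%:R : set BV)) @ \oo --> 1%E.
  rewrite -L1 -bigcup_unif_ball; apply: nondecreasing_cvg_mu => //.
  exact: bigcupT_measurable.
have n1 : nbhs 1%E [set x : \bar R | (1 - e%:E < x)%E].
  apply: open_nbhs_nbhs; split; first exact: open_ereal_gt_ereal.
  by rewrite /= lte_fin ltrBlDr ltrDl.
move=> /(_ _ n1) [m _ /(_ m (leqnn m))] /= Lm; exists m.
rewrite (probability_setC _ (measurable_unif_ball _)).
have : (L (unif_ball m%:R : set BV) \is a fin_num) by exact: fin_num_measure.
move: Lm; case: (L _) => // r.
by rewrite -!EFinB lte_fin lee_fin; lra.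
Qed.

Lemma empirical_process_ellinfty n (w : n.-tuple O) : donsker P F ->
  ellinfty F (empirical_process P F w : V).
Proof.
move=> [_ Fb _].
(* [donsker] bounds the class at each point separately; a sample has finitely many points, so one
   bound is chosen per observation. *)
have [C CP] : exists C : 'I_n -> R,
    forall i f, F f -> `|f (tnth w i) - \int[P]_x f x| <= C i.
  by exists (fun i => projT1 (cid (Fb (tnth w i)))) => i; case: cid.
exists (Num.sqrt n%:R * (n%:R^-1 * \sum_(i < n) C i)) => f Ff.
rewrite /empirical_process normrM (ger0_norm (sqrtr_ge0 _)).
have [n0|n0] := eqVneq n 0%N; first by rewrite [in _%:R]n0 sqrtr0 !mul0r.
have nR0 : n%:R != 0 :> R by rewrite pnatr_eq0.
rewrite ler_wpM2l//.
have -> : n%:R^-1 * \sum_(i < n) f (tnth w i) - \int[P]_o f o =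
    n%:R^-1 * \sum_(i < n) (f (tnth w i) - \int[P]_o f o).
  rewrite sumrB sumr_const card_ord mulrBr -(mulr_natl (\int[P]_o f o)).
  by rewrite mulKf.
rewrite normrM ger0_norm ?invr_ge0// ler_wpM2l ?invr_ge0//.
by rewrite (le_trans (ler_norm_sum _ _ _))// ler_sum// => i _; exact: CP.
Qed.

(* The limit law gives mass almost [1] to a ball of radius [m]; testing the weak
   convergence against [cutoff m] and using Markov's inequality then bounds the
   outer probability that the empirical process leaves the ball of radius
   [m + 1]. *)
Lemma donsker_glivenko_cantelli (g : forall n, n.-tuple O -> O -> R) (eta : R) :
  donsker P F -> 0 < eta ->
  negl P (fun n => [set w | F (g n w) /\
    eta < `|n%:R^-1 * \sum_(i < n) g n w (tnth w i) - \int[P]_o g n w o| ]).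
Proof.
move=> dF eta0; have [_ _ [L [L1 _ Lcv]]] := dF.
apply/neglP => e e0; have e2 : 0 < e / 2 by rewrite divr_gt0.
have [m Lm] := law_ellinfty_unif_ball L1 e2.
pose H : V -> R := cutoff m%:R.
have Hint : (\int[L]_(z in ellinfty F) (H z)%:E <= (e / 2)%:E)%E.
  apply: le_trans Lm.
  have mB : measurable (~` (unif_ball m%:R : set V) : set BV).
    by apply: measurableC; exact: measurable_unif_ball.
  apply: (@le_trans _ _ (L ((~` (unif_ball m%:R : set V)) `&` ellinfty F))).
    rewrite -(integral_indic L measurable_ellinfty mB).
    apply: ge0_le_integral_nomeas => z _; rewrite !lee_fin indicE.
    have /andP[-> H1] := cutoff01 m%:R (z : V); rewrite /=.
    have [//|/negP zB] := boolP (z \in _).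
    have zB' : unif_ball m%:R (z : V).
      by apply: contrapT => zN; apply: zB; exact/mem_set.
    by rewrite /H cutoff_eq0.
  by apply: le_measure; rewrite ?inE//; exact: measurableI.
have Hb : exists C : R, forall z : V, ellinfty F z -> `|H z| <= C.
  by exists 1 => z _; have /andP[? ?] := cutoff01 m%:R z; rewrite ger0_norm.
have := Lcv H (@cutoff_continuous _ _ _ _ _) Hb.
set l := (\int[L]_(z in _) _)%E in Hint *.
have ne : nbhs l [set x : \bar R | (x < e%:E)%E].
  apply: open_nbhs_nbhs; split; first exact: open_ereal_lt_ereal.
  by rewrite /= (le_lt_trans Hint)// lte_fin; lra.
move=> /(_ _ ne) [N1 _ N1P].
near=> n.
(* The outer expectation is an infimum over integrable majorants; one with expectation below [e] is
   measurable, and Markov's inequality applies to it. *)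
have /ereal_inf_lt[_ [U [iU HU] <-] Ue] :
    (outer_expectation (iid_law P n)
      (fun w => H (empirical_process P F w)) < e%:E)%E.
  by apply: N1P; near: n; exact: nbhs_infty_ge.
have U0 w : 0 <= U w.
  by apply: le_trans (HU w); have /andP[] := cutoff01 m%:R (empirical_process P F w : V).
apply: (@le_trans _ _ (((iid_law P n)^*)%mu [set w | 1 <= U w])).
  apply: le_mu_ext => w [Fg etag] /=; apply: le_trans (HU w).
  rewrite /H (@cutoff_eq1 _ _ _ _ _ _ (g n w))//.
    exact: empirical_process_ellinfty.
  rewrite /empirical_process normrM (ger0_norm (sqrtr_ge0 _)).
  apply: (@le_trans _ _ (Num.sqrt n%:R * eta)); last by rewrite ler_wpM2l// ltW.
  rewrite -ler_pdivrMr//.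
  (* A deviation [eta] of the mean is a deviation sqrt(n) eta of the empirical process, which
     exceeds [m + 1] for such [n]. *)
  have : ((m%:R + 1) / eta) ^+ 2 <= n%:R.
    by near: n; exact: nbhs_infty_ger.
  move=> /ler_wsqrtr; rewrite sqrtr_sqr; apply: le_trans.
  exact: ler_norm.
have /measurable_EFinP mU : measurable_fun setT (EFin \o U) by case/integrableP : iU.
rewrite measurable_mu_extE; last first.
  rewrite (_ : [set w | _] = U @^-1` `[1, +oo[%classic).
    by rewrite -[X in measurable X]setTI; apply: mU => //; exact: measurable_itv.
  by apply/seteqP; split => w /=; rewrite in_itv/= andbT.
by rewrite (le_trans (markov_ge1 iU U0))// ltW.
Unshelve. all: by end_near. Qed.

End donsker_bound.

(** Hoeffding's decomposition. Each index occurs n - 1 times in either slot of the ordered pairs,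
    and by symmetry both slots have the projection [g], hence the factor 2. *)
Lemma Ustat_decomposition d (O : measurableType d) (R : realType)
    (P : probability O R) (f : O -> O -> R) n (w : n.-tuple O) :
  (1 < n)%N -> (forall x y, f x y = f y x) ->
  Ustat f w = Ustat (centered P f) w
    + 2 * (n%:R^-1 * \sum_(i < n) integrate_snd P f (tnth w i)
           - \int[P]_o integrate_snd P f o)
    + \int[P]_o integrate_snd P f o.
Proof.
move=> n1 fC; set g := integrate_snd P f; set c := \int[P]_o g o.
have nR0 : n%:R != 0 :> R by rewrite pnatr_eq0 -lt0n (ltn_trans _ n1).
have nR1 : n%:R - 1 != 0 :> R.
  by rewrite subr_eq0 (_ : 1 = 1%:R)// eqr_nat gtn_eqF.
have cardE (i : 'I_n) : \sum_(j < n | i != j) (1 : R) = n%:R - 1.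
  have : \sum_(j < n) (1 : R) = 1 + \sum_(j < n | j != i) 1 by rewrite (bigD1 i).
  rewrite sumr_const card_ord => ->; rewrite addrAC subrr add0r.
  by apply: eq_bigl => j; rewrite eq_sym.
have constE (i : 'I_n) (a : R) : \sum_(j < n | i != j) a = (n%:R - 1) * a.
  by rewrite -(cardE i) mulr_suml; apply: eq_bigr => j _; rewrite mul1r.
pose S := \sum_(i < n) g (tnth w i).
have S1 : \sum_(i < n) \sum_(j < n | i != j) g (tnth w i) = (n%:R - 1) * S.
  by rewrite mulr_sumr; apply: eq_bigr => i _; rewrite constE.
have S2 : \sum_(i < n) \sum_(j < n | i != j) g (tnth w j) = (n%:R - 1) * S.
  rewrite (exchange_big_dep xpredT)//= mulr_sumr; apply: eq_bigr => j _.
  by under eq_bigl do rewrite eq_sym; rewrite constE.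
have S3 : \sum_(i < n) \sum_(j < n | i != j) c = n%:R * (n%:R - 1) * c.
  under eq_bigr do rewrite constE.
  by rewrite sumr_const card_ord -[LHS]mulr_natl mulrA.
have cE x y : centered P f x y = f x y - g x - g y + c.
  rewrite /centered /g /integrate_snd; congr (_ - _ + _).
  by apply: eq_Rintegral => o _; rewrite fC.
rewrite /Ustat; under [in RHS]eq_bigr do under eq_bigr do rewrite cE.
under [in RHS]eq_bigr do rewrite big_split/= !sumrB.
rewrite big_split/= !sumrB S1 S2 S3 -/S.
by field; rewrite nR0 nR1.
Qed.

(** * Consistency of the test *)

(** Jensen's inequality: the mean of a difference is at most its quadratic mean. *)
Lemma Rintegral_dist_le_normLp2 d (O : measurableType d) (R : realType)
    (P : probability O R) (f g : O -> O -> R) :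
  bmfun (uncurry f) -> bmfun (uncurry g) ->
  `|\int[P]_o integrate_snd P f o - \int[P]_o integrate_snd P g o| <=
  normLp P 2 (integrate_snd P (fun x y => f x y - g x y)).
Proof.
move=> bf bg.
have bf1 := bmfun_Rintegral P bf; have bg1 := bmfun_Rintegral P bg.
have -> : integrate_snd P (fun x y => f x y - g x y) =
    (fun x => integrate_snd P f x - integrate_snd P g x).
  apply/funext => x; rewrite /integrate_snd RintegralB_bm//.
    exact: bmfun_slice bf.
  exact: bmfun_slice bg.
rewrite normLp2E; last by apply: bmfunB.
rewrite -RintegralB_bm// -sqrtr_sqr ler_wsqrtr//.
by apply: Rintegral_sqr_le; apply: bmfunB.
Qed.

Theorem corollary3 (R : realType) (d : measure_display) (O : measurableType d)
    (M : set (probability O R)) (P0 : probability O R)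
    (hatP : forall n : nat, n.-tuple O -> probability O R)
    (RT ST : mapping O R) (F : set (O -> R))
    (alpha : R) (q : forall n : nat, n.-tuple O -> R)
    (M_nonparametric : nonparametric M) (M_P0 : M P0)
    (M_hatP : forall (n : nat) (w : n.-tuple O), M (hatP n w))
    (RT_S : in_S M P0 RT) (ST_S : in_S M P0 ST)
    (alpha01 : 0 < alpha < 1)
    (reject_measurable : forall n : nat, measurable (reject RT ST hatP q n))
    (q_level : eq_in_dist P0 (map_val RT P0) (map_val ST P0) ->
      (limn_esup (fun n : nat => iid_law P0 n (reject RT ST hatP q n))
       <= alpha%:E)%E)
    (K1_small : little_oP P0 (fun n w => K1 P0 RT ST (hatP n w))
                          (fun n => (Num.sqrt n%:R)^-1))
    (Un_small : little_oP P0
      (fun n w => Ustat (centered P0 (Gamma RT ST (hatP n w))) w)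
      (fun n => (Num.sqrt n%:R)^-1))
    (F_donsker : donsker P0 F)
    (Gamma_in_F : wp_to_1 P0
      (fun n => [set w | F (integrate_snd P0 (Gamma RT ST (hatP n w)))]))
    (Gamma_L2 : little_oP P0
      (fun n w => normLp P0 2 (integrate_snd P0
         (fun o1 o2 => Gamma RT ST (hatP n w) o1 o2 - Gamma RT ST P0 o1 o2)))
      (fun=> 1))
    (tau2_gt0 : (0 < tau2 P0 RT ST)%E)
    (q_small : little_oP P0 q (fun n => n%:R))
    (not_null : ~ eq_in_dist P0 (map_val RT P0) (map_val ST P0)) :
  iid_law P0 n (reject RT ST hatP q n) @[n --> \oo] --> 1%E.
Proof.
have arith (c e x y z : R) : c = 8 * e ->
    `|x| <= e -> `|y| <= e -> `|z - c| <= e -> 4 * e <= x + 2 * y + z.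
  by move=> ->; rewrite !ler_norml => /andP[? ?] /andP[? ?] /andP[? ?]; lra.
apply: negl_setC_cvg1 => //.
pose c := \int[P0]_u \int[P0]_v Gamma RT ST P0 u v.
have c0 : 0 < c.
  rewrite /c (Rintegral_Gamma M_P0 RT_S ST_S).
  exact: mmd_gt0 (bmfun_map_val RT_S M_P0) (bmfun_map_val ST_S M_P0) not_null.
(* The three errors cost at most e + 2e + e, which leaves [psi] at least 4e out of 8e, while the
   cutoff stays below e n. *)
have [e e0 ce] : exists2 e, 0 < e & c = 8 * e.
  by exists (c / 8); [rewrite divr_gt0|rewrite mulrC divfK].
pose g n w := integrate_snd P0 (Gamma RT ST (hatP n w)).
have GC := donsker_glivenko_cantelli g F_donsker e0.
have bad := neglU (neglU (neglU (neglU (Un_small e e0) Gamma_in_F) GC)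
  (Gamma_L2 e e0)) (q_small e e0).
(* For large [n], a sample that is not rejected must lie in one of the five bad events; otherwise
   all the bounds below hold together and contradict acceptance. *)
apply: neglS bad; near=> n => w; rewrite /reject /= => /negP.
rewrite -leNgt => npsi; apply: contrapT.
move=> /not_orP[/not_orP[/not_orP[/not_orP[]]]].
move=> /negP + /contrapT Fg + /negP + /negP.
rewrite -!leNgt mulr1 => U_e Pn_e L2_e q_e.
have {}Pn_e : `|n%:R^-1 * \sum_(i < n) g n w (tnth w i) - \int[P0]_o g n w o| <= e.
  rewrite leNgt; apply/negP => h; exact: (Pn_e (conj Fg h)).
have n1 : (1 < n)%N by near: n; exact: nbhs_infty_gt.
have nR1 : 1 <= n%:R :> R by rewrite ler1n ltnW.
(* For n >= 1 the level e / sqrt(n) is at most [e]. *)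
have {}U_e : `|Ustat (centered P0 (Gamma RT ST (hatP n w))) w| <= e.
  apply: (le_trans U_e); rewrite ler_piMr// ?(ltW e0)//.
  rewrite invf_le1 ?sqrtr_gt0 ?(lt_le_trans ltr01)//.
  by rewrite -[leLHS]sqrtr1 ler_wsqrtr.
have g_e : `|\int[P0]_o g n w o - c| <= e.
  apply: le_trans (le_trans (ler_norm _) L2_e).
  exact: Rintegral_dist_le_normLp2 (bmfun_Gamma RT_S ST_S (M_hatP n w))
    (bmfun_Gamma RT_S ST_S M_P0).
have psi_e : 4 * e <= psi RT ST hatP w.
  rewrite /psi (Ustat_decomposition P0 w n1 (@GammaC _ _ _ RT ST (hatP n w))).
  exact: arith ce U_e Pn_e g_e.
move: npsi q_e; rewrite ler_norml => npsi /andP[_ q_e].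
have : n%:R * (4 * e) <= e * n%:R.
  by rewrite (le_trans _ q_e)// (le_trans _ npsi)// ler_wpM2l.
by rewrite mulrC ler_pM2r ?(lt_le_trans ltr01)// leNgt ltr_pMl// ltr1n.
Unshelve. all: by end_near. Qed.
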